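(* Let $\mu$ be a zero-mean probability measure on $(\mathbb{R},\mathcal{B}(\mathbb{R}))$ such that the regular Root barrier solving the Skorokhod embedding problem for $\mu$ is given by a barrier function $r$ that is symmetric around $0$, continuous, and nonincreasing on $[0,\infty]$. Then $r$ solves the nonlinear Volterra integral equation of the first kind $$u_{\delta_0}(x)-u_\mu(x)=g\bigl(r(x),x\bigr)-\int_x^\infty\Bigl(g\bigl(r(x)-r(y),x+y\bigr)+g\bigl(r(x)-r(y),x-y\bigr)\Bigr)\mu(\mathrm{d}y)\qquad\text{for all }x\in(0,\infty).$$
   Context: $B=(B_t)_{t\ge 0}$ is a standard one-dimensional Brownian motion started at $0$. A stopping time $\tau$ solves the Skorokhod embedding problem for $\mu$ if $B_\tau\sim\mu$ and $B^\tau=(B_{t\wedge\tau})_{t\ge0}$ is uniformly integrable. A Root barrier is a closed set $R\subset[0,\infty]\times[-\infty,\infty]$ such that (1) $(t,x)\in R$ implies $(t+h,x)\in R$ for all $h\ge0$; (2) $(+\infty,x)\in R$ for all $x\in[-\infty,\infty]$; (3) $(t,\pm\infty)\in R$ for all $t\in[0,+\infty]$. Its barrier function is $r:[-\infty,\infty]\to[0,\infty]$, $r(x)=\inf\{t\ge0:(t,x)\in R\}$; one has $R=\{(t,x):t\ge r(x)\}$. The first positive zero of $r$ is the point $x_+\in[0,\infty]$ with $r(x_+)=0$ and $r(x)>0$ for $x\in[0,x_+)$; the first negative zero $x_-\in[-\infty,0]$ is defined analogously. $R$ (or $r$) is called regular if $r$ vanishes outside $[x_-,x_+]$. For every zero-mean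 probability measure $\mu$ on $\mathbb{R}$ there is exactly one regular Root barrier $R$ such that $\tau=\inf\{t>0:(t,B_t)\in R\}$ solves the Skorokhod embedding problem for $\mu$ (Root, Loynes, Rost). For a probability measure $\nu$ with finite first moment, $u_\nu(x)=-\int_{\mathbb{R}}|x-y|\,\nu(\mathrm{d}y)$ is its potential function; $\delta_0$ is the Dirac measure at $0$, so $u_{\delta_0}(x)=-|x|$. Further $$g(t,x)=\sqrt{\tfrac{2t}{\pi}}\,e^{-x^2/(2t)}-|x|\operatorname{Erfc}\Bigl(\tfrac{|x|}{\sqrt{2t}}\Bigr)=\mathbb{E}[L_t^x]$$ (so $g(0,x)=0$), where $(L_t^x)_{t,x}$ is the local time of $B$ and $\operatorname{Erfc}(z)=\frac{2}{\sqrt\pi}\int_z^\infty e^{-v^2}\mathrm{d}v$.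
   Formalization: At points x with r(x)=+∞ the right-hand side reads ∞−∞ and is undefined; there the equation is stated as the limit, as t→∞, of the right-hand side with t in place of r(x) (g being 0 at nonpositive times). Where r(x) is finite the equation is literal. *)

(* Defs.v *)
From HB Require Import structures.
From mathcomp Require Import all_boot all_order all_algebra.
From mathcomp Require Import all_classical all_reals all_analysis.

Set Implicit Arguments.
Unset Strict Implicit.
Unset Printing Implicit Defensive.

Import Order.TTheory GRing.Theory Num.Theory.
Import numFieldNormedType.Exports.

Local Open Scope classical_set_scope.
Local Open Scope ring_scope.

Section brownian_motion.
Context {d : measure_display} {Omega : measurableType d} {R : realType}.
Implicit Types (P : probability Omega R) (B X : R -> Omega -> R)
  (tau : Omega -> \bar R).

(* Processes are indexed by all of R; only the times t >= 0 are meaningful. *)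

(* Factors may be made trivial by taking A i = setT, so the product rule over
   all n increments gives mutual independence. *)
Definition independent_increments P B :=
  forall (n : nat) (t : nat -> R) (A : nat -> set R),
    0 <= t 0%N ->
    (forall i, t i <= t i.+1) ->
    (forall i, measurable (A i)) ->
    P [set w | forall i, (i < n)%N -> A i (B (t i.+1) w - B (t i) w)] =
    (\prod_(i < n) P [set w | A i (B (t i.+1) w - B (t i) w)%R])%E.

(* The second parameter of normal_prob is the standard deviation. *)
Definition brownian_motion P B :=
  [/\ forall t : R, 0 <= t -> measurable_fun [set: Omega] (B t),
      forall w, B 0 w = 0,
      forall w, {within `[0, +oo[, continuous (fun t => B t w)},
      forall (s t : R) (A : set R), 0 <= s -> s < t -> measurable A ->
        P [set w | A (B t w - B s w)] = normal_prob 0 (Num.sqrt (t - s)) A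
    & independent_increments P B].

Definition natural_filtration B (t : R) : set (set Omega) :=
  <<s [set E | exists (s : R) (A : set R),
         [/\ 0 <= s, s <= t, measurable A & E = B s @^-1` A]] >>.

(* Stopping times refer to the right-continuous natural filtration of B: a
   first entrance over t > 0 is in general not one for the raw filtration. *)
Definition stopping_time B tau :=
  (forall w, (0 <= tau w)%E) /\
  forall t s : R, 0 <= t -> t < s ->
    natural_filtration B s [set w | (tau w <= t%:E)%E].

Definition stopped B tau (t : R) (w : Omega) : R :=
  B (fine (Order.min t%:E (tau w))) w.

Definition uniformly_integrable P X :=
  forall e : R, 0 < e -> exists2 c : R, 0 <= c &
    forall t : R, 0 <= t ->
      (\int[P]_(w in [set w | (c <= `|X t w|)%R]) `|X t w|%:E <= e%:E)%E.

(* B_tau is only defined on {tau < +oo}, which has to be almost sure; the value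
   used by fine off this event is irrelevant. *)
Definition solves_skorokhod P B (mu : probability R R) tau :=
  [/\ stopping_time B tau,
      {ae P, forall w, (tau w < +oo)%E},
      forall A : set R, measurable A ->
        P [set w | A (B (fine (tau w)) w)] = mu A
    & uniformly_integrable P (stopped B tau)].

End brownian_motion.

Section root_barrier.
Context {R : realType}.
Implicit Types (K : set (\bar R * \bar R)) (r : \bar R -> \bar R).
Local Open Scope ereal_scope.

Definition root_barrier K :=
  [/\ closed K,
      K `<=` [set tx | 0 <= tx.1],
      forall t x h, K (t, x) -> 0 <= h -> K (t + h, x),
      forall x, K (+oo, x)
    & forall t, 0 <= t -> K (t, -oo) /\ K (t, +oo)].

Definition barrier_function K (x : \bar R) : \bar R :=
  ereal_inf [set t | 0 <= t /\ K (t, x)].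

Definition first_positive_zero r (xp : \bar R) :=
  [/\ 0 <= xp, r xp = 0 & forall x, 0 <= x -> x < xp -> 0 < r x].

Definition first_negative_zero r (xm : \bar R) :=
  [/\ xm <= 0, r xm = 0 & forall x, xm < x -> x <= 0 -> 0 < r x].

Definition regular_barrier_function r :=
  exists xm xp, [/\ first_negative_zero r xm, first_positive_zero r xp
    & forall x, x < xm \/ xp < x -> r x = 0].

Definition hitting_time {d : measure_display} {Omega : measurableType d}
    (B : R -> Omega -> R) K (w : Omega) : \bar R :=
  ereal_inf [set t%:E | t in [set t : R | (0 < t)%R /\ K (t%:E, (B t w)%:E)]].

End root_barrier.

Section potential.
Context {R : realType}.

Definition zero_mean (mu : probability R R) :=
  mu.-integrable setT (EFin : R -> \bar R) /\ (\int[mu]_y y = 0)%R.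

Definition potential (nu : probability R R) (x : R) : R :=
  - (\int[nu]_y `|x - y|)%R.

Definition Erfc (z : R) : R :=
  2 / Num.sqrt pi *
  (\int[lebesgue_measure]_(v in `[z, +oo[) expR (- v ^+ 2))%R.

(* The expected Brownian local time E[L_t^x]. The formula is singular at t = 0, where g vanishes; the
   value 0 is also used for t < 0. *)
Definition g (t x : R) : R :=
  if t <= 0 then 0
  else Num.sqrt (2 * t / pi) * expR (- (x ^+ 2 / (2 * t)))
       - `|x| * Erfc (`|x| / Num.sqrt (2 * t)).

(* The right-hand side of the integral equation with the level t in place of
   r x. If r y = +oo or r y >= t the integrand vanishes, since then
   fine (t%:E - r y%:E) <= 0. *)
Definition volterra_rhs (mu : probability R R) (r : \bar R -> \bar R)
    (t x : R) : R :=
  g t x -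
  (\int[mu]_(y in `]x, +oo[) (g (fine (t%:E - r y%:E)%E) (x + y)
                            + g (fine (t%:E - r y%:E)%E) (x - y)))%R.

End potential.

(* Main.v *)
(* Write W for the Brownian motion, tau for the hitting time, S_T for the value
   of W at min(T, tau), and assume T <= r x. Since E|x - W_u| = |x| + g u x, the
   strong Markov property at min(T, tau) gives
     |x| + g T x = E|x - W_T| = E|x - S_T| + E g (T - min(T, tau)) (x - S_T).
   On tau <= T one has tau = r W_tau, so the last term is the integral of
   g (T - r y) (x - y) against mu; the integrand vanishes for |y| <= x because
   r y >= r x >= T there, and the symmetry of mu folds it onto y > x. Hence
   volterra_rhs mu r T x = E|x - S_T| - |x|.
   If r x = t is finite, take T = t: after time t the path stays below x until
   tau, so |x - W_tau| + W_tau = |x - S_t| + S_t, and both S_t and W_tau have mean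
   zero. If r x is infinite, let T tend to +oo, using uniform integrability.
   The strong Markov property and the symmetry of S_T are obtained by
   approximating min(T, tau) by first passage times on finer and finer grids. *)

Require Import Defs.
From HB Require Import structures.
From mathcomp Require Import all_boot all_order all_algebra.
From mathcomp Require Import all_classical all_reals all_analysis.
From mathcomp Require Import measurable_realfun.
From mathcomp Require Import ring lra.

Set Implicit Arguments.
Unset Strict Implicit.
Unset Printing Implicit Defensive.
Import Order.TTheory GRing.Theory Num.Theory.
Import numFieldNormedType.Exports.

Local Open Scope classical_set_scope.
Local Open Scope ring_scope.

(** * Absolute moments of the normal distribution *)

(** The function [g] enters through E|y + W_u| = |y| + g u y, a Gaussian computation; its sign and
    its continuity down to time 0 are derived from this expectation by triangle inequalities. The
    obstacle is the passage from grids to min(T, tau): the set of times s with r(W_s) - s <= 0 is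
    closed and may be met between grid points only. For e > 0 the condition r(W_s) - s < e is open,
    so fine grids detect it; then e tends to 0, because a continuous function that is positive on a
    compact interval is bounded away from 0 there. Capping r by a real number keeps the function
    real-valued and continuous where r is infinite. The Markov and symmetry identities survive both
    limits because they are tested against bounded continuous functions; |x - y| is reached through
    its truncations. Symmetry also does the work of optional stopping: it gives S_T mean zero and,
    as T grows, makes mu symmetric. *)

Lemma normr_add_sub_max {R : realDomainType} (a v : R) : 0 <= a ->
  `|a + v| + `|- a + v| = 2 * Num.max a `|v|.
Proof.
move=> a0; have [v0|v0] := ger0P v.
  by have [av|va] := leP a v; case: (ger0P (a + v)); case: (ger0P (- a + v)); lra.
by have [av|va] := leP a (- v); case: (ger0P (a + v)); case: (ger0P (- a + v)); lra.
Qed.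

Section gaussian.
Context {R : realType}.
Notation mu := (@lebesgue_measure R).

(** Change of variables holds with the Radon-Nikodym derivative, which is only almost everywhere
    equal to [normal_pdf]; equality of the integrals over all measurable sets provides this. *)
Lemma integral_normal_prob (m s : R) (f : R -> \bar R) :
  measurable_fun setT f -> (forall x, 0 <= f x)%E ->
  (\int[normal_prob m s]_x f x = \int[mu]_x (f x * (normal_pdf m s x)%:E))%E.
Proof.
move=> mf f0.
have dom := normal_prob_dominates m s.
rewrite -(Radon_Nikodym_SigmaFinite.change_of_variables dom)//.
set h := Radon_Nikodym_SigmaFinite.f _ _.
have ih := Radon_Nikodym_SigmaFinite.f_integrable dom.
have mpdf : measurable_fun setT (fun x => (normal_pdf m s x)%:E).
  by apply/measurable_EFinP; exact: measurable_normal_pdf.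
apply: ae_eq_integral => //.
- by apply: emeasurable_funM => //; exact: (measurable_int mu).
- exact: emeasurable_funM.
- apply: ae_eqe_mul2l => /=; apply: integral_ae_eq => //= E ET mE.
  by rewrite -(Radon_Nikodym_SigmaFinite.f_integral dom).
Qed.

Lemma ge0_integral_lebesgueN (f : R -> \bar R) :
  measurable_fun setT f -> (forall x, 0 <= f x)%E ->
  (\int[mu]_x f (- x)%R = \int[mu]_x f x)%E.
Proof.
move=> mf f0.
have mN : measurable_fun setT (-%R : measurableTypeR R -> measurableTypeR R).
  exact: oppr_measurable.
rewrite -[setT in LHS](preimage_setT (-%R : measurableTypeR R -> measurableTypeR R)).
rewrite -(ge0_integral_pushforward mN mu measurableT mf)//.
by apply: eq_measure_integral => //= A mA _; exact: lebesgue_measureN.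
Qed.

Variable s : R.
Hypothesis s_gt0 : 0 < s.
Let s_neq0 : s != 0. Proof. by rewrite gt_eqF. Qed.
Notation phi := (normal_pdf 0 s : R -> R).

Lemma normal_pdf_even (x : R) : phi (- x) = phi x.
Proof. by rewrite normal_pdfE// /normal_fun !subr0 sqrrN. Qed.

(** With this scale (x k)^2 = x^2 / (2 s^2), so [phi] is a rescaled [gauss_fun], whose tail is
    [Erfc]. *)
Let k := (Num.sqrt 2 * s)^-1.
Let k_gt0 : 0 < k. Proof. by rewrite invr_gt0 mulr_gt0// sqrtr_gt0. Qed.

Lemma normal_pdf_gauss : phi = (fun x => normal_peak s * gauss_fun (x * k)).
Proof.
apply/funext => x; rewrite normal_pdfE// /normal_fun /gauss_fun subr0.
congr (_ * expR _); rewrite /k exprMn exprVn exprMn sqr_sqrtr//.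
by rewrite mulNr mulr_natl.
Qed.

Lemma cvg_mulk : x * k @[x --> +oo] --> +oo.
Proof. by apply: gt0_cvgMly => //; exact: cvg_id. Qed.

Lemma normal_pdf_cvg0 : phi x @[x --> +oo] --> (0 : R).
Proof.
rewrite normal_pdf_gauss -[0](mulr0 (normal_peak s)); apply: cvgMl_tmp.
exact: (cvg_comp _ _ cvg_mulk cvg_gauss_fun).
Qed.

Lemma is_derive_mulk (x : R) : is_derive x (1:R) (fun x : R => x * k) k.
Proof.
apply: (@is_derive_eq _ _ _ (id * cst k)).
by rewrite scaler0 add0r /cst /= /GRing.scale/= mulr1.
Qed.

Lemma is_derive_gauss (x : R) :
  is_derive x (1:R) (@gauss_fun R) (- (2 * x) * gauss_fun x).
Proof.
have h : is_derive x (1:R) (- (id ^+ 2 : R -> R)) (- (2 * x)).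
  by apply: is_derive_eq; rewrite /GRing.scale/= mulr1 expr1 mulr_natl.
have := @is_derive1_comp R (@expR R) _ x _ _ (is_derive_expR _) h.
rewrite mulrC; exact.
Qed.

Lemma is_derive_normal_pdf (x : R) :
  is_derive x (1:R) phi (- (x / s ^+ 2) * phi x).
Proof.
have h := @is_derive1_comp R (@gauss_fun R) _ x _ _ (is_derive_gauss _) (is_derive_mulk x).
rewrite normal_pdf_gauss.
have h2 := @is_deriveZ _ _ _ (gauss_fun \o (fun x => x * k)) (normal_peak s) x (1:R) _ h.
apply: (is_derive_eq h2); rewrite /GRing.scale/=.
have -> : (s ^+ 2)^-1 = 2 * k ^+ 2.
  rewrite /k exprVn exprMn sqr_sqrtr//; field.
  by rewrite gt_eqF.
ring.
Qed.

(** The antiderivative - s^2 phi of v phi(v) vanishes at infinity. *)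
Lemma integral_first_moment (a : R) : 0 <= a ->
  (\int[mu]_(v in `[a, +oo[) (v * phi v)%:E = (s ^+ 2 * phi a)%:E)%E.
Proof.
move=> a0.
have dF v : is_derive v (1:R) (- s ^+ 2 *: phi) (v * phi v).
  apply: (is_derive_eq (@is_deriveZ _ _ _ phi (- s ^+ 2) v (1:R) _ (is_derive_normal_pdf v))).
  by rewrite /GRing.scale/=; field; exact: lt0r_neq0.
have F0 : (- s ^+ 2 *: phi) x @[x --> +oo] --> (0 : R).
  rewrite -[X in _ --> X](mulr0 (- s ^+ 2)).
  rewrite [X in X @ _ --> _](_ : _ = fun x => - s ^+ 2 * phi x)//.
  by apply: cvgMl_tmp; exact: normal_pdf_cvg0.
rewrite (@ge0_continuous_FTC2y _ _ (- s ^+ 2 *: phi) a 0)//.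
- by rewrite -EFinB sub0r -[(- s ^+ 2 *: phi) a]/(- s ^+ 2 * phi a) mulNr opprK.
- by move=> x ax; rewrite mulr_ge0 ?normal_pdf_ge0// (le_trans a0).
- apply: continuous_subspaceT => x; apply: cvgM; first exact: cvg_id.
  exact: continuous_normal_pdf.
- apply: cvg_at_right_filter; apply: differentiable_continuous; exact/derivable1_diffP/ex_derive.
- by move=> x _; rewrite derive1E derive_val.
Qed.

Lemma integral_gauss_tail (a : R) :
  (\int[mu]_(x in `[a, +oo[) (gauss_fun x)%:E = (Erfc a * (Num.sqrt pi / 2))%:E)%E.
Proof.
have fi : mu.-integrable `[a, +oo[ (EFin \o @gauss_fun R).
  by apply: integrableS integrableT_gauss.
rewrite /Erfc /Rintegral.
rewrite -[LHS]fineK; last exact: integrable_fin_num.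
congr EFin; rewrite -[in RHS]/(gauss_fun _).
under [in RHS]eq_integral do rewrite -/(gauss_fun _).
by field; rewrite gt_eqF// sqrtr_gt0 pi_gt0.
Qed.

Lemma normal_peakE : normal_peak s = k / Num.sqrt pi.
Proof.
rewrite /normal_peak /k -invfM; congr (_^-1).
rewrite -mulr_natr -mulrA mulrC sqrtrM ?mulr_ge0 ?pi_ge0// sqrtrM ?pi_ge0//.
by rewrite sqrtr_sqr gtr0_norm//; ring.
Qed.

Lemma integral_normal_pdf_tail (a : R) :
  (\int[mu]_(v in `[a, +oo[) (phi v)%:E = (Erfc (a * k) / 2)%:E)%E.
Proof.
have sub := @increasing_ge0_integration_by_substitutiony R (fun x => x * k) (@gauss_fun R) a.
have dE : (fun x : R => x * k)^`()%classic = cst k.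
  by apply/funext => x; rewrite derive1E; have := is_derive_mulk x => h; exact: derive_val.
have := integral_gauss_tail (a * k).
rewrite dE in sub.
rewrite sub.
- move=> h.
  transitivity (\int[mu]_(v in `[a, +oo[) ((Num.sqrt pi)^-1%:E * (((gauss_fun \o *%R^~ k) * cst k)%R v)%:E))%E.
    apply: eq_integral => v _; rewrite normal_pdf_gauss normal_peakE; congr EFin.
    rewrite -[((gauss_fun \o _) * _)%R v]/(gauss_fun (v * k) * k).
    by rewrite [k / _]mulrC -mulrA [k * _]mulrC.
  rewrite ge0_integralZl//=.
  + rewrite h -EFinM; congr EFin; field.
    by rewrite gt_eqF// sqrtr_gt0 pi_gt0.
  + apply/measurable_EFinP; apply: measurable_funM => //.
    apply: measurable_funTS; apply: measurableT_comp; first exact: measurable_gauss_fun.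
    exact: measurable_funM.
  + by move=> v _; rewrite lee_fin mulr_ge0 ?gauss_fun_ge0// ltW.
- by move=> x y _ _ xy; rewrite ltr_pM2r.
- by move=> x _; exact: cvg_cst.
- exact: is_cvg_cst.
- exact: is_cvg_cst.
- split.
    by move=> x _; have := is_derive_mulk x => h; exact: ex_derive.
  by apply: cvg_at_right_filter; apply: cvgMr_tmp; exact: cvg_id.
- exact: cvg_mulk.
- by apply: continuous_subspaceT; exact: continuous_gauss_fun.
- by move=> x _; exact: gauss_fun_ge0.
Qed.

Lemma integral_normal_pdf0y :
  (\int[mu]_(v in `[0%R, +oo[) (phi v)%:E = (2^-1)%:E)%E.
Proof.
have := integral_normal_pdf 0 s.
rewrite ge0_symfun_integralT.
- rewrite -set_itvcy => h.
  have fi : mu.-integrable `[0%R, +oo[ (fun x => (phi x)%:E).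
    by apply: integrableS (integrable_normal_pdf 0 s).
  have := integrable_fin_num _ fi.
  move=> /(_ (measurable_itv _)); move: h; case: (\int[mu]_(v in _) _)%E => // r.
  rewrite -EFinM => -[] h _; congr EFin; lra.
- by move=> x; exact: normal_pdf_ge0.
- exact: continuous_normal_pdf.
- by move=> x; rewrite /= normal_pdf_even.
Qed.

(** By evenness this is twice the integral over v >= 0. Below [a] the maximum is [a], on a mass of
    1/2 - Erfc (a k) / 2; above [a] it is v, and the first moment of the tail remains. *)
Lemma integral_max_normal_pdf (a : R) : 0 <= a ->
  (\int[mu]_v (Num.max a `|v| * phi v)%:E = (a + 2 * s ^+ 2 * phi a - a * Erfc (a * k))%:E)%E.
Proof.
move=> a0.
have cm : continuous (fun v => Num.max a `|v| * phi v).
  move=> x; apply: cvgM; last exact: continuous_normal_pdf.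
  apply: (@continuous_max R R (cst a) Num.norm); first exact: cvg_cst.
  exact: norm_continuous.
rewrite ge0_symfun_integralT; first last.
- by move=> x; rewrite /= normal_pdf_even normrN.
- done.
- by move=> x; rewrite mulr_ge0 ?normal_pdf_ge0// le_max a0.
rewrite -set_itvcy.
have := integral_normal_pdf0y.
rewrite (@itv_bndbnd_setU _ _ (BLeft 0) (BLeft a) +oo%O)//=.
have mphi D : measurable_fun D (fun v => (phi v)%:E).
  by apply/measurable_EFinP; apply: measurable_funTS; exact: measurable_normal_pdf.
have mmphi D : measurable_fun D (fun v : R => (Num.max a `|v| * phi v)%:E).
  by apply/measurable_EFinP; apply: measurable_funTS; exact: continuous_measurable_fun.
rewrite !ge0_integral_setU//=.
- rewrite integral_normal_pdf_tail => h.
  rewrite [X in (_ * (_ + X))%E](_ : _ = (s ^+ 2 * phi a)%:E); last first.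
    rewrite -integral_first_moment//; apply: eq_integral => v; rewrite inE/= in_itv/= andbT => av.
    by rewrite ger0_norm ?(le_trans a0)// max_r.
  rewrite [X in (_ * (X + _))%E](_ : _ = (a%:E * \int[mu]_(x in `[0%R, a[) (phi x)%:E))%E; last first.
    rewrite -ge0_integralZl//=.
    - apply: eq_integral => v; rewrite inE/= in_itv/= => /andP[v0 va].
      by rewrite ger0_norm// max_l// ltW.
    - exact: mphi.
    - by move=> v _; rewrite lee_fin normal_pdf_ge0.
  have fi : mu.-integrable `[0%R, a[ (fun x => (phi x)%:E).
    by apply: integrableS (integrable_normal_pdf 0 s).
  have := integrable_fin_num _ fi.
  move=> /(_ (measurable_itv _)); move: h; case: (\int[mu]_(v in `[0%R, a[) _)%E => // r.
  rewrite -!EFinD -!EFinM => -[] h _; congr EFin.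
  have -> : r = 2^-1 - Erfc (a * k) / 2 by apply: (addIr (Erfc (a * k) / 2)); rewrite h subrK.
  by field.
- exact: mmphi.
- by move=> v _; rewrite lee_fin mulr_ge0 ?normal_pdf_ge0// le_max a0.
- apply/disj_setPS => v []/=; rewrite !in_itv/= andbT => /andP[_ va].
  by rewrite leNgt va.
- exact: mphi.
- by move=> v _; rewrite lee_fin normal_pdf_ge0.
- apply/disj_setPS => v []/=; rewrite !in_itv/= andbT => /andP[_ va].
  by rewrite leNgt va.
Qed.

(** The normal law is even, so y may be replaced by |y| or by -|y|. Adding these two versions turns
    the integrand into 2 max(|y|, |v|), which spares a case distinction on the sign of y + v. *)
Lemma integral_normr_normal (y : R) :
  (\int[normal_prob 0 s]_v (`|y + v|)%:E = (`|y| + g (s ^+ 2) y)%:E)%E.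
Proof.
have gE : `|y| + g (s ^+ 2) y = `|y| + 2 * s ^+ 2 * phi `|y| - `|y| * Erfc (`|y| * k).
  rewrite /g leNgt exprn_gt0//= -addrA; congr (_ + (_ - _)).
    rewrite normal_pdfE// /normal_fun subr0 real_normK ?num_real//.
    rewrite mulNr mulr_natl mulrA; congr (_ * _).
    rewrite normal_peakE sqrtrM ?mulrn_wge0 ?sqr_ge0// sqrtrV ?pi_ge0// mulrA.
    congr (_ * _); rewrite -mulr_natr sqrtrM ?sqr_ge0// sqrtr_sqr gtr0_norm// /k.
    have q0 : Num.sqrt 2 != 0 :> R by rewrite gt_eqF// sqrtr_gt0.
    have q2 : Num.sqrt 2 ^+ 2 = 2 :> R by rewrite sqr_sqrtr.
    apply: (@mulIf _ (Num.sqrt 2 * s)); first by rewrite mulf_neq0.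
    rewrite divfK ?mulf_neq0//; transitivity (s ^+ 2 * Num.sqrt 2 ^+ 2); first by ring.
    by rewrite q2.
  congr (_ * Erfc (_ * _)); rewrite /k sqrtrM ?ler0n// sqrtr_sqr gtr0_norm//.
have mf z : measurable_fun [set: R] (fun v : R => (`|z + v|)%:E).
  by apply/measurable_EFinP; apply: measurableT_comp => //; exact: measurable_funD.
have mp z : measurable_fun [set: R] (fun v : R => (`|z + v| * phi v)%:E).
  apply/measurable_EFinP; apply: measurable_funM; last exact: measurable_normal_pdf.
  by apply: measurableT_comp => //; exact: measurable_funD.
rewrite integral_normal_prob//.
pose I z := (\int[mu]_v (`|z + v| * phi v)%:E)%E.
have IN z : I (- z) = I z.
  rewrite /I -ge0_integral_lebesgueN//.
    by apply: eq_integral => v _; rewrite -opprD normrN normal_pdf_even.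
  by move=> v; rewrite lee_fin mulr_ge0 ?normal_pdf_ge0.
transitivity (I `|y|).
  rewrite -[LHS]/(I y).
  by have [y0|/ltW y0] := leP 0 y; [rewrite ger0_norm|rewrite ler0_norm// IN].
have h : (I `|y|%R + I `|y|%R)%E = (2%:E * \int[mu]_v (Num.max `|y| `|v| * phi v)%R%:E)%E.
  rewrite -{2}IN -ge0_integralD//.
  - rewrite -ge0_integralZl//.
    + apply: eq_integral => v _; rewrite -EFinD -EFinM; congr EFin.
      rewrite mulrA -mulrDl; congr (_ * _).
      exact: normr_add_sub_max.
    + apply/measurable_EFinP; apply: measurable_funM; last exact: measurable_normal_pdf.
      by apply: measurable_maxr => //; exact: measurableT_comp.
    + by move=> v _; rewrite lee_fin mulr_ge0 ?normal_pdf_ge0// le_max normr_ge0.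
  - by move=> v _; rewrite lee_fin mulr_ge0 ?normal_pdf_ge0.
  - exact: mp.
  - by move=> v _; rewrite lee_fin mulr_ge0 ?normal_pdf_ge0.
  - exact: mp.
rewrite integral_max_normal_pdf// -gE in h.
move: h; case: (I _) => // r; rewrite -EFinD -EFinM => -[] h; congr EFin; lra.
Qed.

End gaussian.

(** * Laws of Brownian increments *)

Section tuple_boxes.
Context {R : realType}.

Definition box n (A : 'I_n -> set R) : set (n.-tuple R) :=
  [set x | forall i, A i (tnth x i)].

Lemma measurable_box n (A : 'I_n -> set R) :
  (forall i, measurable (A i)) -> measurable (box A).
Proof.
move=> mA.
have -> : box A = \bigcap_(i in [set: 'I_n]) ((fun x : n.-tuple R => tnth x i) @^-1` A i).
  by apply/seteqP; split => [x xA i _|x xA i]; exact: xA.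
apply: fin_bigcap_measurable => // i _.
by rewrite -[X in measurable X]setTI; exact: measurable_tnth.
Qed.

(** Boxes are stable under intersection, contain the whole space and generate the product
    sigma-algebra, since each cylinder is a box with all other factors trivial. *)
Lemma tuple_measure_unique n (m1 m2 : {measure set (n.-tuple R) -> \bar R}) :
  (m1 setT < +oo)%E ->
  (forall A : 'I_n -> set R, (forall i, measurable (A i)) ->
    m1 (box A) = m2 (box A)) ->
  forall E, measurable E -> m1 E = m2 E.
Proof.
move=> m1oo m12 E mE.
pose G := [set box A | A in [set A : 'I_n -> set R | forall i, measurable (A i)]].
have boxT : box (fun=> setT) = [set: n.-tuple R] by apply/seteqP; split.
apply: (@g_sigma_algebra_measure_unique _ _ _ G _ (fun=> setT)) => //.
- by move=> _ [A mA <-]; exact: measurable_box.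
- by move=> _; exists (fun=> setT).
- by apply/seteqP; split => // x _; exists 0%N.
- move=> _ _ [A mA <-] [A' mA' <-]; exists (fun i => A i `&` A' i).
    by move=> i; exact: measurableI.
  by apply/seteqP; split=> [x xA|x [xA xA'] i]; [split=> i; case: (xA i)|split].
- by move=> _ [A mA <-]; exact: m12.
- move: mE; apply: smallest_sub; first exact: smallest_sigma_algebra.
  rewrite -bigcup_seq => B [/= i _ [Y mY <-]]; apply: sub_sigma_algebra.
  exists (fun j => if j == i then Y else setT).
    by move=> j; case: ifP.
  rewrite setTI; apply/seteqP; split => [x /(_ i)|x xY j]; first by rewrite eqxx.
  by case: eqP => // ->.
Qed.

End tuple_boxes.

(** * Increments along an increasing sequence of times *)

Section increments.
Context {d : measure_display} {Omega : measurableType d} {R : realType}.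
Variables (P : probability Omega R) (W : R -> Omega -> R).
Hypothesis mW : forall t, measurable_fun [set: Omega] (W t).
Hypothesis W0 : forall w, W 0 w = 0.
Hypothesis normalW : forall (s t : R) (A : set R), 0 <= s -> s < t -> measurable A ->
  P [set w | A (W t w - W s w)] = normal_prob 0 (Num.sqrt (t - s)) A.
Hypothesis indepW : independent_increments P W.

Variable u : nat -> R.
Hypothesis u0 : u 0%N = 0.
Hypothesis u_lt : forall i, u i < u i.+1.

Let u_ge0 i : 0 <= u i.
Proof. by elim: i => [|i IH]; rewrite ?u0// (le_trans IH)// ltW. Qed.

Definition increments k w : k.-tuple R := [tuple W (u i.+1) w - W (u i) w | i < k].

Lemma measurable_increments k : measurable_fun [set: Omega] (increments k).
Proof.
apply/measurable_fun_tnthP => i.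
rewrite [X in measurable_fun _ X](_ : _ = fun w => W (u i.+1) w - W (u i) w).
  exact: measurable_funB.
by apply/funext => w/=; rewrite tnth_mktuple.
Qed.

HB.instance Definition _ k :=
  isMeasurableFun.Build _ _ _ _ (increments k) (@measurable_increments k).

Definition path_of k (x : k.-tuple R) (j : nat) : R := \sum_(i < k | (i < j)%N) tnth x i.

Lemma path_of_increments k w (j : nat) : (j <= k)%N -> path_of (increments k w) j = W (u j) w.
Proof.
move=> jk; rewrite /path_of.
under eq_bigr do rewrite tnth_mktuple.
rewrite (big_ord_narrow jk)/=.
rewrite -(big_mkord xpredT (fun i => W (u i.+1) w - W (u i) w)).
by rewrite telescope_sumr// u0 W0 subr0.
Qed.

Lemma measurable_path_of k j : measurable_fun [set: k.-tuple R] (fun x => path_of x j).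
Proof.
rewrite [X in measurable_fun _ X](_ : _ = fun x : k.-tuple R =>
    \sum_(i <- index_enum 'I_k) (if (i < j)%N then tnth x i else 0)).
  have h := @measurable_sum _ (k.-tuple R) R setT 'I_k (index_enum 'I_k)
    (fun i x => if (i < j)%N then tnth x i else 0).
  refine (h _); move=> i; case: (i < j)%N; [exact: measurable_tnth|exact: measurable_cst].
by apply/funext => x; rewrite /path_of big_mkcond.
Qed.

(** [independent_increments] takes a family indexed by nat; this extends a finite family to such a
    one. *)
Let ext k (A : 'I_k -> set R) (C : nat -> set R) (j : nat) : set R :=
  if insub j is Some i then A i else C j.

Lemma increments_box_last k (T : R) (A : 'I_k -> set R) (C : set R) : u k <= T ->
  (forall i, measurable (A i)) -> measurable C ->
  P (increments k @^-1` box A `&` [set w | C (W T w - W (u k) w)]) =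
  (\prod_(i < k) P [set w | A i (W (u i.+1) w - W (u i) w)%R] *
   P [set w | C (W T w - W (u k) w)%R])%E.
Proof.
move=> ukT mA mC.
(* The times u_0, ..., u_k, T, T, ...: the increment number k of this sequence is the one from u_k
   to T. *)
pose v i := if (i <= k)%N then u i else T.
have mE i : measurable (ext A (fun=> C) i) by rewrite /ext; case: insubP.
have v0 : 0 <= v 0%N by rewrite /v u0.
have v_le i : v i <= v i.+1.
  rewrite /v; have [ik|ki] := leqP i k.
    case: (ltnP i k) => [_|ki]; first exact: ltW.
    by have -> : i = k by apply/eqP; rewrite eqn_leq ik.
  by rewrite ifF// leqNgt ltnS ltnW.
have extk (i : 'I_k) : ext A (fun=> C) i = A i.
  by rewrite /ext; case: insubP => [j _ ij|]; [congr A; exact/val_inj|rewrite ltn_ord].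
have extC : ext A (fun=> C) k = C by rewrite /ext; case: insubP => //; rewrite ltnn.
have := indepW k.+1 v0 v_le mE.
rewrite big_ord_recr/= extC.
under eq_bigr => i _ do rewrite extk.
have vE (i : nat) : (i <= k)%N -> v i = u i by rewrite /v => ->.
have vT : v k.+1 = T by rewrite /v ltnn.
rewrite vT vE//.
under eq_bigr => i _ do rewrite !vE ?(ltnW (ltn_ord i))//.
move=> <-.
  congr (P _); apply/seteqP; split=> [w [wA wC] i|w wAC].
    rewrite ltnS leq_eqVlt => /predU1P[->|ik].
      by rewrite extC /v leqnn ltnn.
    by have := wA (Ordinal ik); rewrite tnth_mktuple -extk /v/= ik ltnW.
  split; last by have := wAC k (ltnSn k); rewrite extC /v leqnn ltnn.
  move=> i; have := wAC i (ltnW (ltn_ord i)).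
  by rewrite extk tnth_mktuple /v ltn_ord ltnW.
Qed.

Lemma increments_box k (A : 'I_k -> set R) : (forall i, measurable (A i)) ->
  P (increments k @^-1` box A) =
  (\prod_(i < k) P [set w | A i (W (u i.+1) w - W (u i) w)%R])%E.
Proof.
move=> mA; have := increments_box_last (lexx (u k)) mA measurableT.
have -> : [set w | setT (W (u k) w - W (u k) w)] = [set: Omega] by exact/seteqP.
by rewrite setIT probability_setT mule1.
Qed.

(** For fixed [C] both sides are finite measures in [E]: a restriction of P pushed forward, and a
    multiple of the law of the increments. They agree on boxes. *)
Lemma increments_indep k (T : R) (E : set (k.-tuple R)) (C : set R) : u k <= T ->
  measurable E -> measurable C ->
  P (increments k @^-1` E `&` [set w | C (W T w - W (u k) w)]) =
  (P (increments k @^-1` E) * P [set w | C (W T w - W (u k) w)%R])%E.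
Proof.
move=> ukT mE mC.
pose Y w := W T w - W (u k) w.
have mY : measurable_fun setT Y by exact: measurable_funB.
have mYC : measurable (Y @^-1` C) by rewrite -[X in measurable X]setTI; exact: mY.
have PYC : (P (Y @^-1` C) < +oo)%E by rewrite ltey_eq fin_num_measure.
have PY0 : 0 <= fine (P (Y @^-1` C)) by rewrite fine_ge0.
pose m1 := pushforward (mfrestr mYC PYC) (increments k).
pose m2 := mscale (NngNum PY0) (distribution P (increments k)).
have m12 : m1 E = m2 E.
  apply: tuple_measure_unique => //.
  - by apply: (le_lt_trans _ PYC); apply: measureIr => //; rewrite -[X in measurable X]setTI; exact: measurable_increments.
  - move=> A mA; rewrite -[LHS]/(P (increments k @^-1` box A `&` [set w | C (W T w - W (u k) w)])).
    rewrite -[RHS]/((fine (P (Y @^-1` C)))%:E * P (increments k @^-1` box A))%E.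
    rewrite increments_box// increments_box_last// fineK ?fin_num_measure//.
    by rewrite muleC.
move: m12; rewrite /m1 /m2 /pushforward /mfrestr /mrestr /mscale /distribution /pushforward/= => ->.
by rewrite muleC fineK ?fin_num_measure.
Qed.

Lemma distribution_increment (s t : R) : 0 <= s -> s < t ->
  forall f : R -> \bar R, measurable_fun setT f -> (forall x, 0 <= f x)%E ->
  (\int[P]_w f (W t w - W s w)%R = \int[normal_prob 0 (Num.sqrt (t - s))]_x f x)%E.
Proof.
move=> s0 st f mf f0.
pose Y w : measurableTypeR R := W t w - W s w.
have mY : measurable_fun setT Y by exact: measurable_funB.
pose mYm := isMeasurableFun.Build _ _ _ _ Y mY.
pose Ym : {mfun Omega >-> measurableTypeR R} := HB.pack Y mYm.
rewrite -[LHS](@ge0_integral_distribution _ _ _ _ _ P Ym f)//.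
apply: eq_measure_integral => A mA _.
by rewrite /= -(normalW s0 st mA).
Qed.

Lemma normal_prob_sym (s : R) (A : set R) : 0 < s -> measurable A ->
  normal_prob 0 s (-%R @^-1` A) = normal_prob 0 s A.
Proof.
move=> s0 mA; rewrite /normal_prob.
have mNA : measurable (-%R @^-1` A : set R).
  by rewrite -[X in measurable X]setTI; exact: oppr_measurable.
rewrite integral_mkcond [RHS]integral_mkcond -ge0_integral_lebesgueN.
- apply: eq_integral => x _; rewrite !patchE /= normal_pdf_even//.
  by congr (if _ then _ else _); apply/idP/idP; rewrite !inE /= ?opprK.
- apply/(measurable_restrictT _ _).1 => //.
  by apply/measurable_EFinP/measurable_funTS; exact: measurable_normal_pdf.
- by move=> x; rewrite patchE; case: ifPn => // _; rewrite lee_fin normal_pdf_ge0.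
Qed.

(** On boxes both sides factor into laws of single increments, and each centred normal law is
    even. *)
Lemma increments_sym k (E : set (k.-tuple R)) : measurable E ->
  P (increments k @^-1` E) =
  P [set w | E [tuple - (W (u i.+1) w - W (u i) w) | i < k]].
Proof.
move=> mE.
pose N (x : k.-tuple R) : k.-tuple R := [tuple - tnth x i | i < k].
have mN : measurable_fun setT N.
  apply/measurable_fun_tnthP => i.
  rewrite [X in measurable_fun _ X](_ : _ = fun x => - tnth x i).
    by apply: measurableT_comp => //; exact: measurable_tnth.
  by apply/funext => w/=; rewrite tnth_mktuple.
have mNi : measurable_fun setT (N \o increments k) by exact: measurableT_comp.
pose Nm := isMeasurableFun.Build _ _ _ _ (N \o increments k) mNi.
pose Ni : {mfun Omega >-> k.-tuple R} := HB.pack (N \o increments k) Nm.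
have -> : [set w | E [tuple - (W (u i.+1) w - W (u i) w) | i < k]] = Ni @^-1` E.
  apply/seteqP; split=> w /=; (have -> : N (increments k w) = [tuple - (W (u i.+1) w - W (u i) w) | i < k]; last by []); by apply: eq_from_tnth => i; rewrite !tnth_mktuple.
have := @tuple_measure_unique _ k (distribution P (increments k)) (distribution P Ni) _ _ E mE; apply.
  by apply: (@le_lt_trans _ _ 1%E); [exact: probability_le1|exact: ltry].
move=> A mA; rewrite -[LHS]/(P (increments k @^-1` box A)) -[RHS]/(P (Ni @^-1` box A)) increments_box//.
have -> : Ni @^-1` box A = increments k @^-1` box (fun i => -%R @^-1` A i).
  apply/seteqP; split=> w /= wA i; have := wA i; by rewrite /N !tnth_mktuple.
have mAN i : measurable (-%R @^-1` A i : set R).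
  by rewrite -[X in measurable X]setTI; exact: oppr_measurable.
rewrite increments_box//; apply: eq_bigr => i _.
rewrite normalW// [RHS](normalW (u_ge0 i) (u_lt i) (mAN i)).
rewrite normal_prob_sym// sqrtr_gt0 subr_gt0//.
Qed.

(** Independence makes the joint law a product, and Tonelli integrates over the future increment
    with the past frozen. The second variable [w'] is a fresh copy that drives the future only. *)
Lemma increments_markov k (T : R) (F : k.-tuple R * R -> \bar R) : u k < T ->
  measurable_fun setT F -> (forall z, 0 <= F z)%E ->
  (\int[P]_w F (increments k w, W T w - W (u k) w)%R =
   \int[P]_w \int[P]_w' F (increments k w, W T w' - W (u k) w')%R)%E.
Proof.
move=> ukT mF F0.
pose Y w := W T w - W (u k) w.
have mY : measurable_fun setT Y by exact: measurable_funB.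
pose mYm := isMeasurableFun.Build _ _ _ _ Y mY.
pose Ym : {mfun Omega >-> R} := HB.pack Y mYm.
pose X w := (increments k w, Y w).
have mX : measurable_fun setT X by apply/measurable_fun_pairP; split => //; exact: measurable_increments.
pose Xm' := isMeasurableFun.Build _ _ _ _ X mX.
pose Xm : {mfun Omega >-> (k.-tuple R * R)%type} := HB.pack X Xm'.
rewrite -[LHS](@ge0_integral_distribution _ _ _ _ _ P Xm F)//.
have h A : measurable A -> (distribution P (increments k) \x distribution P Ym)%E A = distribution P Xm A.
  apply: product_measure_unique => A1 A2 mA1 mA2.
  rewrite -[LHS]/(P (increments k @^-1` A1 `&` [set w | A2 (W T w - W (u k) w)])).
  by rewrite increments_indep ?(ltW ukT).
transitivity (\int[distribution P (increments k) \x distribution P Ym]_z F z)%E.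
  by apply: eq_measure_integral => A mA _; exact/esym/h.
rewrite fubini_tonelli1// ge0_integral_distribution//.
- apply: eq_integral => w _; rewrite /= /fubini_F ge0_integral_distribution//.
  exact: measurableT_comp.
- exact: measurable_fun_fubini_tonelli_F.
- by move=> x; apply: integral_ge0.
Qed.

End increments.

(** The right-hand side does not involve [m]: whether the first success occurs at [k] is decided by
    the indices up to [k]. This is what makes a grid index a stopping rule. *)
Lemma find_iota_eq (p : pred nat) k m : (k < m)%N ->
  (find p (iota 0 m) == k) = all (fun j => ~~ p j) (iota 0 k) && p k.
Proof.
move=> km; have -> : iota 0 m = iota 0 k ++ k :: iota k.+1 (m - k.+1).
  by rewrite -[in LHS](subnKC km) addSnnS iotaD add0n.
rewrite find_cat size_iota -[all _ _]negbK -has_predC /=.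
rewrite (eq_has (a2 := p)); last by move=> j /=; rewrite negbK.
case: ifPn => [h|h] /=.
  by apply/negP => /eqP fk; move: h; rewrite has_find size_iota fk ltnn.
case: (p k); first by rewrite addn0 eqxx.
by apply/negP => /eqP; rewrite -[RHS]addn0 => /addnI.
Qed.

(** * First passage times of continuous functions *)

Section first_passage.
Context {R : realType}.
Implicit Types (psi : R -> R) (T : R).

(** Adjoining T caps the time at T and keeps the infimum over a nonempty set. *)
Definition passage_time (S : set R) T : R := inf ([set s | 0 <= s <= T /\ S s] `|` [set T]).

Lemma passage_time_bounds (S : set R) T : 0 <= T -> 0 <= passage_time S T <= T.
Proof.
move=> T0; apply/andP; split.
  by apply: lb_le_inf; [exists T; right|move=> s [[/andP[]]|->]].
by apply: ge_inf; [exists 0 => s [[/andP[]]|->]|right].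
Qed.

Lemma passage_time_le (S : set R) T s : 0 <= s <= T -> S s -> passage_time S T <= s.
Proof.
move=> /andP[s0 sT] Ss; apply: ge_inf; first by exists 0 => x [[/andP[]]|->]//; exact: le_trans sT.
by left; rewrite /= s0 sT.
Qed.

Lemma passage_time_adherent (S : set R) T c : 0 <= T -> passage_time S T < c ->
  T < c \/ exists2 s, 0 <= s <= T /\ s < c & S s.
Proof.
move=> T0 tc; have [s [[sT Ss]|->] sc] : exists2 s, ([set s | 0 <= s <= T /\ S s] `|` [set T]) s & s < c.
- have cE : passage_time S T + (c - passage_time S T) = c by rewrite addrC subrK.
  have h : has_inf ([set s | 0 <= s <= T /\ S s] `|` [set T]).
    by split; [exists T; right|exists 0 => x [[/andP[]]|->]].
  have e0 : 0 < c - passage_time S T by rewrite subr_gt0.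
  have [s Ss] := inf_adherent e0 h.
  by rewrite -/(passage_time _ _) cE; exists s.
- by right; exists s.
- by left.
Qed.

Lemma passage_time_notin (S : set R) T s : 0 <= s -> s < passage_time S T -> 0 <= T -> ~ S s.
Proof.
move=> s0 st T0 Ss; have /andP[_ tT] := passage_time_bounds S T0.
have : passage_time S T <= s by apply: passage_time_le => //; rewrite s0 (le_trans (ltW st)).
by rewrite leNgt st.
Qed.

Definition below psi (e : R) : set R := [set s | psi s < e].
Definition nonpos psi : set R := [set s | psi s <= 0].

Definition grid T n (k : nat) : R := T * k%:R / n.+1%:R.

(* The value is n.+1, that is the time T, if psi is at least e at all earlier
   grid points. *)
Definition grid_index psi (e T : R) n : nat :=
  find (fun k => psi (grid T n k) < e) (iota 0 n.+1).

Lemma gridT T n : grid T n n.+1 = T.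
Proof. by rewrite /grid mulfK. Qed.

Lemma grid0 T n : grid T n 0 = 0.
Proof. by rewrite /grid mulr0 mul0r. Qed.

Lemma grid_ge0 T n k : 0 <= T -> 0 <= grid T n k.
Proof. by move=> T0; rewrite /grid !mulr_ge0. Qed.

Lemma grid_le T n k l : 0 <= T -> (k <= l)%N -> grid T n k <= grid T n l.
Proof. by move=> T0 kl; rewrite ler_wpM2r// ler_wpM2l// ler_nat. Qed.

Lemma grid_lt T n k : 0 < T -> grid T n k < grid T n k.+1.
Proof. by move=> T0; rewrite ltr_pM2r// ltr_pM2l// ltr_nat. Qed.

Lemma grid_index_le psi e T n : (grid_index psi e T n <= n.+1)%N.
Proof. by rewrite /grid_index -[leqRHS](size_iota 0) find_size. Qed.

Lemma grid_index_leP psi e T n k : (k <= n)%N -> psi (grid T n k) < e ->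
  (grid_index psi e T n <= k)%N.
Proof.
move=> kn pk; rewrite leqNgt; apply/negP => /(before_find 0%N).
by rewrite nth_iota ?ltnS// add0n pk.
Qed.

Lemma grid_index_psi psi e T n : (grid_index psi e T n <= n)%N ->
  psi (grid T n (grid_index psi e T n)) < e.
Proof.
move=> kn; have := @nth_find _ 0%N (fun k => psi (grid T n k) < e) (iota 0 n.+1).
by rewrite has_find size_iota ltnS nth_iota// add0n; exact.
Qed.

Lemma grid_index_eq psi e T n k : (k <= n)%N ->
  (grid_index psi e T n == k) =
  (all (fun j => ~~ (psi (grid T n j) < e)) (iota 0 k) && (psi (grid T n k) < e)).
Proof. by move=> kn; rewrite /grid_index find_iota_eq. Qed.

(** A grid entrance is an entrance, so the grid times lie above the limit. Conversely, close to the
    infimum there is a time s with psi s < e; by continuity this persists on an interval around s,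
    which contains a grid point not exceeding s once the mesh is fine. *)
Lemma cvg_grid_below psi e T : 0 <= T -> continuous psi ->
  grid T n (grid_index psi e T n) @[n --> \oo] --> passage_time (below psi e) T.
Proof.
move=> T0 cpsi; set tau := passage_time _ _.
have /andP[tau0 tauT] : 0 <= tau <= T by exact: passage_time_bounds.
have leT n : grid T n (grid_index psi e T n) <= T.
  by rewrite -[leRHS](gridT T n) grid_le// grid_index_le.
have tau_le n : tau <= grid T n (grid_index psi e T n).
  have := grid_index_le psi e T n; rewrite leq_eqVlt => /predU1P[->|].
    by rewrite gridT.
  rewrite ltnS => h; apply: passage_time_le; first by rewrite grid_ge0// leT.
  exact: grid_index_psi.
move: T0; rewrite le_eqVlt => /predU1P[T0|T0].
  rewrite (_ : (fun n => _) = fun=> tau); first exact: cvg_cst.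
  apply/funext => n; apply/eqP; rewrite eq_le tau_le andbT.
  by apply: le_trans (leT n) _; rewrite -T0.
apply/cvgrPdist_lt => eta eta0.
suff : \forall n \near \oo, grid T n (grid_index psi e T n) < tau + eta.
  apply: filterS => n h; rewrite ler0_norm ?subr_le0// opprB.
  by rewrite ltrBlDl.
have tt : tau < tau + eta by rewrite ltrDl.
have [Tt|[s [/andP[s0 sT] st] ps]] := passage_time_adherent (ltW T0) tt.
  by apply: nearW => n; exact: le_lt_trans (leT n) Tt.
have : \forall x \near s, psi x < e.
  by exact: (cvgr_lt (psi s) (cpsi s) e ps).
move=> /nbhs_ballP[del /= del0 hdel].
near=> n.
have nT : T / n.+1%:R < del.
  rewrite ltr_pdivrMr// -ltr_pdivrMl// mulrC.
  apply: (@lt_trans _ _ n%:R); last by rewrite ltr_nat.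
  by near: n; exact: nbhs_infty_gtr.
(* The last grid point not exceeding s has this index. *)
set k := Num.truncn (s * n.+1%:R / T).
have q0 : 0 <= s * n.+1%:R / T by rewrite divr_ge0 ?mulr_ge0// ltW.
have /andP[kle klt] := truncn_itv q0; rewrite -/k in kle klt.
have gk : grid T n k <= s.
  by rewrite /grid ler_pdivrMr// mulrC -ler_pdivlMr.
have sk : s < grid T n k + T / n.+1%:R.
  rewrite /grid -mulrDl ltr_pdivlMr// -[X in _ + X]mulr1 -mulrDr natr1 mulrC.
  by rewrite [T * _]mulrC -ltr_pdivrMr// [_ * s]mulrC.
apply: le_lt_trans st.
have kn : (k <= n.+1)%N.
  rewrite -(ler_nat R) (le_trans kle)// ler_pdivrMr// mulrC ler_pM2l//.
apply: (le_trans _ gk); apply: grid_le; first exact: ltW.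
move: kn; rewrite leq_eqVlt => /predU1P[->|kn]; first exact: grid_index_le.
apply: grid_index_leP => //; apply: hdel.
suff : `|s - grid T n k| < del by [].
rewrite ger0_norm ?subr_ge0//.
by apply: (@le_lt_trans _ _ (T / n.+1%:R)) => //; rewrite lerBlDl ltW.
Unshelve. all: by end_near. Qed.

(** The entrance below a positive threshold comes no later than the limit. It comes at most eta
    earlier as soon as the threshold is less than the minimum of psi over [0, tau - eta], which is
    positive. *)
Lemma cvg_below_nonpos psi T : 0 <= T -> continuous psi ->
  passage_time (below psi m.+1%:R^-1) T @[m --> \oo] --> passage_time (nonpos psi) T.
Proof.
move=> T0 cpsi; set tau := passage_time (nonpos psi) _.
have /andP[tau0 tauT] : 0 <= tau <= T by exact: passage_time_bounds.
have le_tau m : passage_time (below psi m.+1%:R^-1) T <= tau.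
  rewrite leNgt; apply/negP => h.
  have [Tt|[s [s0T st] ps]] := passage_time_adherent T0 h.
    by have /andP[_ h2] := passage_time_bounds (below psi m.+1%:R^-1) T0; move: Tt; rewrite ltNge h2.
  have : passage_time (below psi m.+1%:R^-1) T <= s.
    by apply: passage_time_le => //; rewrite /below/= (le_lt_trans ps).
  by rewrite leNgt st.
apply/cvgrPdist_le => eta eta0.
have [te|te] := leP tau eta.
  apply: nearW => m; rewrite ger0_norm ?subr_ge0// (le_trans _ te)// gerBl.
  by have /andP[] := passage_time_bounds (below psi m.+1%:R^-1) T0.
have te0 : 0 <= tau - eta by rewrite subr_ge0 ltW.
have cc : {within `[0, tau - eta], continuous psi} by exact: continuous_subspaceT.
have [c ci cmin] := EVT_min te0 cc.
have c0 : 0 < psi c.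
  move: ci; rewrite in_itv/= => /andP[c0 ct]; rewrite ltNge; apply/negP.
  have ctau : c < tau by rewrite (le_lt_trans ct)// ltrBlDr ltrDl.
  exact: (passage_time_notin c0 ctau T0).
near=> m.
have mc : m.+1%:R^-1 < psi c.
  near: m; exact: near_infty_natSinv_lt (PosNum c0).
rewrite ger0_norm ?subr_ge0// lerBlDl -lerBlDr.
apply: lb_le_inf; first by exists T; right.
move=> s [[/andP[s0 sT] ps]|->]; last first.
  by rewrite (le_trans _ tauT)// gerBl ltW.
rewrite leNgt; apply/negP => st.
have : psi c <= psi s by apply: cmin; rewrite in_itv/= s0 ltW.
by rewrite leNgt (lt_trans ps mc).
Unshelve. all: by end_near. Qed.

(** If psi were positive at the passage time, no entrance times could accumulate there from the
    right; if it were negative, psi would be negative slightly earlier, or already at time 0. *)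
Lemma passage_time_nonpos_eq0 psi T : 0 <= T -> continuous psi -> 0 <= psi 0 ->
  passage_time (nonpos psi) T < T -> psi (passage_time (nonpos psi) T) = 0.
Proof.
move=> T0 cpsi psi0; set tau := passage_time _ _ => tT.
have /andP[tau0 _] : 0 <= tau <= T by exact: passage_time_bounds.
apply/eqP; rewrite eq_le; apply/andP; split; rewrite leNgt; apply/negP => h.
- have : \forall x \near tau, 0 < psi x by exact: (cvgr_gt (psi tau) (cpsi tau) 0 h).
  move=> /nbhs_ballP[del /= del0 hdel].
  have tt : tau < Num.min T (tau + del) by rewrite lt_min tT ltrDl.
  have [|[s [/andP[s0 sT]]]] := passage_time_adherent T0 tt.
    by rewrite lt_min ltxx.
  rewrite lt_min => /andP[_ st] ps.
  have ts : tau <= s by apply: passage_time_le => //; rewrite s0.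
  have : 0 < psi s.
    by apply: hdel; rewrite /ball/= distrC ger0_norm ?subr_ge0// ltrBlDl.
  by rewrite ltNge ps.
- move: tau0; rewrite le_eqVlt => /predU1P[t0|t0].
    by move: h; rewrite -t0 ltNge psi0.
  have : \forall x \near tau, psi x < 0 by exact: (cvgr_lt (psi tau) (cpsi tau) 0 h).
  move=> /nbhs_ballP[del /= del0 hdel].
  pose s := Num.max 0 (tau - del / 2).
  have s0 : 0 <= s by rewrite le_max lexx.
  have st : s < tau by rewrite gt_max t0 ltrBlDr ltrDl divr_gt0.
  apply: (passage_time_notin s0 st T0); apply: ltW; apply: hdel.
  rewrite /ball/= ger0_norm ?subr_ge0 ?(ltW st)// ltrBlDr -ltrBlDl lt_max.
  by apply/orP; right; rewrite ltrD2l ltrN2 ltr_pdivrMr// ltr_pMr// ltr1n.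
Qed.

End first_passage.

(** * The strong Markov property at first passage times *)

Lemma measurable_select d (X : measurableType d) (R : realType) (k : X -> nat) (f : nat -> X -> R) :
  (forall j, measurable [set x | k x = j]) -> (forall j, measurable_fun setT (f j)) ->
  measurable_fun setT (fun x => f (k x) x).
Proof.
move=> mk mf _ Y mY; rewrite setTI.
have -> : (fun x => f (k x) x) @^-1` Y = \bigcup_j ([set x | k x = j] `&` (f j @^-1` Y)).
  by apply/seteqP; split=> [x Yx|x [j _ [<-]]//]; exists (k x).
apply: bigcup_measurable => j _; apply: measurableI => //.
by rewrite -[X in measurable X]setTI; exact: mf.
Qed.

Lemma measurable_find d (X : measurableType d) (p : nat -> X -> bool) m k a :
  (forall j, measurable [set x | p j x]) ->
  measurable [set x | find (p^~ x) (iota a m) = k].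
Proof.
move=> mp; elim: m k a => [|m IH] k a /=.
  case: k => [|k]; first by rewrite (_ : [set _ | _] = setT)//; exact/seteqP.
  by rewrite (_ : [set _ | _] = set0)//; apply/seteqP; split.
case: k => [|k].
  rewrite (_ : [set _ | _] = [set x | p a x])//.
  by apply/seteqP; split=> x /=; case: (p a x).
rewrite (_ : [set _ | _] = (~` [set x | p a x]) `&` [set x | find (p^~ x) (iota a.+1 m) = k]).
  by apply: measurableI => //; exact: measurableC.
apply/seteqP; split=> x /=; first by case: (p a x) => // -[].
by case=> /negP/negbTE -> ->.
Qed.

Section stopping.
Context {d : measure_display} {Omega : measurableType d} {R : realType}.
Variables (P : probability Omega R) (W : R -> Omega -> R).
Implicit Types (f F psi rho : R -> R) (M e s t T y : R).

(* Freezing the paths at 0 for negative times makes them continuous on R. *)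
Definition extended_brownian_motion :=
  [/\ forall t, measurable_fun [set: Omega] (W t),
      forall t w, t <= 0 -> W t w = 0,
      forall w, continuous (W ^~ w),
      forall (s t : R) (A : set R), 0 <= s -> s < t -> measurable A ->
        P [set w | A (W t w - W s w)] = normal_prob 0 (Num.sqrt (t - s)) A
    & independent_increments P W].

(** Joint sequential continuity, stated so that approximating times and the path values at these
    times can be substituted for the two sequences. *)
Definition cvg_continuous2 (H : R -> R -> R) := forall (u v : R^nat) a b,
  u @ \oo --> a -> v @ \oo --> b -> H (u n) (v n) @[n --> \oo] --> H a b.

Definition ge0_bounded (f : R -> R) := exists M, forall x, 0 <= f x <= M.

(** The Brownian transition semigroup; as paths are frozen at 0 for negative times, it is the
    identity for u <= 0. *)
Definition heat (f : R -> R) (u y : R) : R := (\int[P]_w f (y + W u w))%R.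

Lemma bounded_convergence (X_ : nat -> Omega -> R) (X : Omega -> R) (M : R) :
  (forall n, measurable_fun setT (X_ n)) -> (forall n w, 0 <= X_ n w <= M) ->
  (forall w, X_ n w @[n --> \oo] --> X w) ->
  (\int[P]_w (X_ n w)%:E @[n --> \oo] --> \int[P]_w (X w)%:E)%E.
Proof.
move=> mX_ X_M X_X.
have mX : measurable_fun setT X by apply: (measurable_fun_cvg mX_) => w _; exact: X_X.
have mEX_ n : measurable_fun setT (EFin \o X_ n) by exact/measurable_EFinP.
have mEX : measurable_fun setT (EFin \o X) by exact/measurable_EFinP.
have XX : {ae P, forall w, setT w -> (EFin \o X_ n) w @[n --> \oo] --> (EFin \o X) w}.
  by apply: aeW => w _; apply: cvg_EFin; [exact: nearW|exact: X_X].
have iM : P.-integrable setT (cst M%:E) by exact: finite_measure_integrable_cst.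
have le w n : setT w -> (`|(EFin \o X_ n) w| <= cst M%:E w)%E.
  by move=> _; rewrite /= lee_fin; have /andP[X0 XM] := X_M n w; rewrite ger0_norm.
have := dominated_convergence measurableT mEX_ mEX XX iM (aeW P le).
by move=> -[].
Qed.

Lemma bounded_fin_num (X : Omega -> R) (M : R) : measurable_fun setT X ->
  (forall w, 0 <= X w <= M) -> (\int[P]_w (X w)%:E)%E \is a fin_num.
Proof.
move=> mX XM; apply: integrable_fin_num => //.
apply: measurable_bounded_integrable => //.
  by rewrite (le_lt_trans (probability_le1 _ _))// ltry.
exists M; split; first exact: num_real.
move=> x Mx w _ /=; have /andP[X0 Xle] := XM w; rewrite ger0_norm//.
exact: le_trans Xle (ltW Mx).
Qed.

Lemma continuous_cvg_seq (f : R -> R) (u : R^nat) a :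
  continuous f -> u @ \oo --> a -> f (u n) @[n --> \oo] --> f a.
Proof. by move=> cf ua; exact: (cvg_comp _ _ ua (cf a)). Qed.

Lemma cvg_seq_continuous (f : R -> R) :
  (forall (u : R^nat) (a : R), u @ \oo --> a -> f (u n) @[n --> \oo] --> f a) -> continuous f.
Proof.
move=> cf a; have h := (@cvg_nbhsP R R^o f a (f a)).2.
by apply: h => u; exact: cf.
Qed.

Hypothesis bmW : extended_brownian_motion.
Let mW : forall t, measurable_fun [set: Omega] (W t). Proof. by case: bmW. Qed.
Let Wle0 : forall t w, t <= 0 -> W t w = 0. Proof. by case: bmW. Qed.
Let W0 w : W 0 w = 0. Proof. exact: Wle0. Qed.
Let cW : forall w, continuous (W ^~ w). Proof. by case: bmW. Qed.
Let normalW : forall (s t : R) (A : set R), 0 <= s -> s < t -> measurable A ->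
  P [set w | A (W t w - W s w)] = normal_prob 0 (Num.sqrt (t - s)) A.
Proof. by case: bmW. Qed.
Let indepW : independent_increments P W. Proof. by case: bmW. Qed.

Let measurable_comp_W (f : R -> R) u y : measurable_fun setT f ->
  measurable_fun setT (fun w => f (y + W u w)).
Proof.
move=> mf; apply: measurableT_comp => //.
by apply: measurable_funD => //; exact: mW.
Qed.

Lemma heat_bounds f M u y : continuous f -> (forall x, 0 <= f x <= M) -> 0 <= heat f u y <= M.
Proof.
move=> cf fM; have mf := continuous_measurable_fun cf.
have := bounded_fin_num (measurable_comp_W u y mf) (fun w => fM _) => h.
rewrite /heat /Rintegral -!lee_fin fineK//; apply/andP; split.
  by apply: integral_ge0 => w _; rewrite lee_fin; case/andP: (fM (y + W u w)).
apply: (@le_trans _ _ (\int[P]_w M%:E)%E).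
  apply: ge0_le_integral => //.
  - by move=> w _; rewrite lee_fin; case/andP: (fM (y + W u w)).
  - by apply/measurable_EFinP; exact: measurable_comp_W.
  - by move=> w _; rewrite lee_fin; case/andP: (fM (y + W u w)).
by rewrite integral_cst//= probability_setT mule1.
Qed.

Lemma heatE f M u y : continuous f -> (forall x, 0 <= f x <= M) ->
  (heat f u y)%:E = (\int[P]_w (f (y + W u w))%:E)%E.
Proof.
move=> cf fM; rewrite /heat /Rintegral fineK//.
apply: (@bounded_fin_num _ M) => //.
by apply: measurable_comp_W; exact: continuous_measurable_fun.
Qed.

Lemma heat_cvg f T : continuous f -> ge0_bounded f ->
  cvg_continuous2 (fun t y => heat f (T - t) y).
Proof.
move=> cf [M fM] u v a b ua vb.
have mf := continuous_measurable_fun cf.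
rewrite /heat /Rintegral; apply: fine_cvg; rewrite fineK; last first.
  by apply: (@bounded_fin_num _ M) => //; exact: measurable_comp_W.
apply: (@bounded_convergence _ _ M) => [n|n w|w] //.
  exact: measurable_comp_W.
apply: continuous_cvg_seq => //; apply: cvgD => //.
apply: (@continuous_cvg_seq (W ^~ w)) => //.
by apply: cvgB => //; exact: cvg_cst.
Qed.

Lemma heat_le0 f u y : u <= 0 -> heat f u y = f y.
Proof.
move=> u0; rewrite /heat.
under eq_Rintegral do rewrite Wle0// addr0.
by rewrite Rintegral_cst//= probability_setT mulr1.
Qed.

Lemma heat_increment f M s t y : continuous f -> (forall x, 0 <= f x <= M) -> 0 <= s -> s < t ->
  (\int[P]_w (f (y + (W t w - W s w)))%:E = (heat f (t - s) y)%:E)%E.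
Proof.
move=> cf fM s0 st; rewrite (heatE _ _ cf fM).
have mf : measurable_fun setT (fun x => (f (y + x))%:E).
  apply/measurable_EFinP; apply: measurableT_comp; first exact: continuous_measurable_fun.
  exact: measurable_funD.
have f0 x : (0 <= (f (y + x))%:E)%E by rewrite lee_fin; case/andP: (fM (y + x)).
rewrite (distribution_increment mW normalW s0 st mf f0).
rewrite -[t - s]subr0 -(distribution_increment mW normalW (lexx 0) _ mf f0) ?subr_gt0//.
by apply: eq_integral => w _; rewrite W0 !subr0.
Qed.

(* Strong Markov property and symmetry at sigma, without filtrations: testing
   against continuous functions makes them stable under pointwise limits. *)
Record markov_time (T : R) (sigma : Omega -> R) : Prop := MarkovTime {
  markov_time_bounds : forall w, 0 <= sigma w <= T ;
  markov_time_measurable : forall H, cvg_continuous2 H ->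
    measurable_fun setT (fun w => H (sigma w) (W (sigma w) w)) ;
  markov_time_sym : forall F, continuous F -> ge0_bounded F ->
    (\int[P]_w (F (W (sigma w) w))%:E = \int[P]_w (F (- W (sigma w) w))%:E)%E ;
  markov_time_heat : forall f, continuous f -> ge0_bounded f ->
    (\int[P]_w (f (W T w))%:E =
     \int[P]_w (heat f (T - sigma w) (W (sigma w) w))%:E)%E }.

Lemma markov_time_lim T (sigma_ : nat -> Omega -> R) (sigma : Omega -> R) :
  (forall n, markov_time T (sigma_ n)) -> (forall w, sigma_ n w @[n --> \oo] --> sigma w) ->
  markov_time T sigma.
Proof.
move=> gs ss.
have Hs H w : cvg_continuous2 H ->
    H (sigma_ n w) (W (sigma_ n w) w) @[n --> \oo] --> H (sigma w) (W (sigma w) w).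
  by move=> cH; apply: cH => //; exact: (@continuous_cvg_seq (W ^~ w)).
have F2 (F : R -> R) : continuous F -> cvg_continuous2 (fun _ y => F y).
  by move=> cF u v a b _ vb; exact: continuous_cvg_seq.
split.
- move=> w; apply/andP; split.
    apply: (closed_cvg (fun x : R => 0 <= x) (@closed_ge R 0) _ (sigma w) (ss w)).
    by apply: nearW => n; have /andP[] := markov_time_bounds (gs n) w.
  apply: (closed_cvg (fun x : R => x <= T) (@closed_le R T) _ (sigma w) (ss w)).
  by apply: nearW => n; have /andP[] := markov_time_bounds (gs n) w.
- move=> H cH; apply: (@measurable_fun_cvg _ _ _ _ (fun n w => H (sigma_ n w) (W (sigma_ n w) w))).
    by move=> n; exact: (markov_time_measurable (gs n)).
  by move=> w _; exact: Hs.
- move=> F cF [M FM].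
  have cFN : continuous (F \o -%R).
    by move=> x; apply: continuous_comp; [exact: opp_continuous|exact: cF].
  have h1 := @bounded_convergence (fun n w => F (W (sigma_ n w) w)) (fun w => F (W (sigma w) w)) M
    (fun n => markov_time_measurable (gs n) (F2 F cF)) (fun n w => FM _) (fun w => Hs _ w (F2 F cF)).
  have h2 := @bounded_convergence (fun n w => F (- W (sigma_ n w) w)) (fun w => F (- W (sigma w) w)) M
    (fun n => markov_time_measurable (gs n) (F2 _ cFN)) (fun n w => FM _) (fun w => Hs _ w (F2 _ cFN)).
  have e : (fun n => \int[P]_w (F (W (sigma_ n w) w))%:E)%E = (fun n => \int[P]_w (F (- W (sigma_ n w) w))%:E)%E.
    by apply/funext => n; apply: (markov_time_sym (gs n)) => //; exists M.
  rewrite e in h1.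
  exact: (cvg_unique _ h1 h2).
- move=> f cf [M fM].
  have cH : cvg_continuous2 (fun t y => heat f (T - t) y) by apply: heat_cvg => //; exists M.
  have h := @bounded_convergence (fun n w => heat f (T - sigma_ n w) (W (sigma_ n w) w))
    (fun w => heat f (T - sigma w) (W (sigma w) w)) M
    (fun n => markov_time_measurable (gs n) cH) (fun n w => heat_bounds _ _ cf fM) (fun w => Hs _ w cH).
  apply: (cvg_unique _ _ h) => //.
  rewrite (_ : (fun n => _) = fun=> (\int[P]_w (f (W T w))%:E)%E); first exact: cvg_cst.
  apply/funext => n; apply/esym; apply: (markov_time_heat (gs n)) => //; by exists M.
Qed.

(** * Strong Markov property and symmetry of grid times *)

Section grid_times.
Variables (T : R) (T_gt0 : 0 < T) (rho : R -> R) (c_rho : continuous rho)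
  (rhoN : forall x, rho (- x) = rho x) (e : R) (n : nat).

Let u := grid T n.
Let u0 : u 0 = 0. Proof. exact: grid0. Qed.
Let u_lt i : u i < u i.+1. Proof. exact: grid_lt. Qed.

Let incr := (increments W u).
Let mincr k : measurable_fun setT (incr k). Proof. exact: measurable_increments. Qed.
(** The stopping rule is written twice: on vectors of increments, whose laws are known ([hit],
    [tidx]), and on paths ([idx]). *)
Let hit k (x : k.-tuple R) j := rho (path_of x j) - u j < e.
Let idx w := grid_index (fun s => rho (W s w) - s) e T n.
Let tidx (x : n.+1.-tuple R) := find (hit x) (iota 0 n.+1).

Let mhit k j : measurable [set x : k.-tuple R | hit x j].
Proof.
rewrite (_ : [set _ | _] = (fun x : k.-tuple R => rho (path_of x j) - u j) @^-1` `]-oo, e[).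
  have m : measurable_fun setT (fun x : k.-tuple R => rho (path_of x j) - u j).
    apply: measurable_funB => //; apply: measurableT_comp; last exact: measurable_path_of.
    exact: continuous_measurable_fun.
  by rewrite -[X in measurable X]setTI; apply: m => //; exact: measurable_itv.
by apply/seteqP; split => x; rewrite /= in_itv.
Qed.

Let hitE k w j : (j <= k)%N -> hit (incr k w) j = (rho (W (u j) w) - u j < e).
Proof. by move=> jk; rewrite /hit path_of_increments. Qed.

Let tidxE w : tidx (incr n.+1 w) = idx w.
Proof.
apply: eq_in_find => j; rewrite mem_iota add0n => /andP[_ jn].
by rewrite hitE// ltnW.
Qed.

Let mtidx j : measurable [set x | tidx x = j].
Proof. exact: (@measurable_find _ _ (fun j x => @hit n.+1 x j) n.+1 j 0 (@mhit n.+1)). Qed.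

Let tidx_le x : (tidx x <= n.+1)%N.
Proof. by rewrite -[leqRHS](size_iota 0) find_size. Qed.

Let midx j : measurable [set w | idx w = j].
Proof.
rewrite (_ : [set _ | _] = incr n.+1 @^-1` [set x | tidx x = j]).
  by rewrite -[X in measurable X]setTI; apply: mincr => //; exact: mtidx.
by apply/seteqP; split => w /=; rewrite tidxE.
Qed.

Let grid_meas H : cvg_continuous2 H -> measurable_fun setT (fun w => H (u (idx w)) (W (u (idx w)) w)).
Proof.
move=> cH; apply: (@measurable_select _ _ _ idx (fun j w => H (u j) (W (u j) w)) midx) => j.
apply: measurableT_comp => //; apply: continuous_measurable_fun.
by apply: cvg_seq_continuous => v a va; apply: cH => //; exact: cvg_cst.
Qed.

(** Negating all increments preserves their law and negates the path; since [rho] is even, it leaves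
    the grid index unchanged. *)
Let grid_sym F : continuous F -> ge0_bounded F ->
  (\int[P]_w (F (W (u (idx w)) w))%:E = \int[P]_w (F (- W (u (idx w)) w))%:E)%E.
Proof.
move=> cF [M FM].
pose Psi (x : n.+1.-tuple R) := (F (path_of x (tidx x)))%:E.
have mPsi : measurable_fun setT Psi.
  apply/measurable_EFinP.
  apply: (@measurable_select _ _ _ tidx (fun j x => F (path_of x j)) mtidx) => j.
  apply: measurableT_comp; first exact: continuous_measurable_fun.
  exact: measurable_path_of.
have Psi0 x : (0 <= Psi x)%E by rewrite lee_fin; case/andP: (FM (path_of x (tidx x))).
pose N (x : n.+1.-tuple R) : n.+1.-tuple R := [tuple - tnth x i | i < n.+1].
have pathN x j : path_of (N x) j = - path_of x j.
  by rewrite /path_of -sumrN; apply: eq_bigr => i _; rewrite tnth_mktuple.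
have tidxN x : tidx (N x) = tidx x.
  by apply: eq_find => j; rewrite /hit pathN rhoN.
have mN0 : measurable_fun setT N.
  apply/measurable_fun_tnthP => i.
  rewrite [X in measurable_fun _ X](_ : _ = fun x => - tnth x i).
    by apply: measurableT_comp => //; exact: measurable_tnth.
  by apply/funext => w/=; rewrite tnth_mktuple.
have mN : measurable_fun setT (N \o incr n.+1) := measurableT_comp mN0 (@mincr n.+1).
transitivity (\int[P]_w (Psi \o incr n.+1) w)%E.
  by apply: eq_integral => w _; rewrite /Psi /= tidxE path_of_increments// -tidxE.
transitivity (\int[P]_w (Psi \o (N \o incr n.+1)) w)%E; last first.
  apply: eq_integral => w _; rewrite /Psi /= tidxN tidxE pathN path_of_increments// -tidxE//.
pose X1m := isMeasurableFun.Build _ _ _ _ (incr n.+1) (@mincr n.+1).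
pose X1 : {mfun Omega >-> n.+1.-tuple R} := HB.pack (incr n.+1) X1m.
pose X2m := isMeasurableFun.Build _ _ _ _ (N \o incr n.+1) mN.
pose X2 : {mfun Omega >-> n.+1.-tuple R} := HB.pack (N \o incr n.+1) X2m.
rewrite -[LHS](@ge0_integral_distribution _ _ _ _ _ P X1 Psi)//.
rewrite -[RHS](@ge0_integral_distribution _ _ _ _ _ P X2 Psi)//.
apply: eq_measure_integral => E mE _.
have := @increments_sym _ _ _ P W mW normalW indepW u u0 u_lt n.+1 E mE.
move=> h; rewrite -[LHS]/(P (increments W u n.+1 @^-1` E)) h.
rewrite -[RHS]/(P ((N \o incr n.+1) @^-1` E)); congr (P _).
by apply/seteqP; split => w /=; (have -> : N (incr n.+1 w) = [tuple - (W (u i.+1) w - W (u i) w) | i < n.+1]; last by []); by apply: eq_from_tnth => i; rewrite !tnth_mktuple.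
Qed.

(** The event that the index is [k] is a function of the first [k] increments, hence independent of
    the increment from u_k to T. *)
Let grid_markov_on k f M : (k <= n)%N -> continuous f -> (forall x, 0 <= f x <= M) ->
  (\int[P]_w ((f (W T w))%:E * (\1_[set w | idx w = k] w)%:E) =
   \int[P]_w ((heat f (T - u k) (W (u k) w))%:E * (\1_[set w | idx w = k] w)%:E))%E.
Proof.
move=> kn cf fM.
have ukT : u k < T by rewrite -[ltRHS](gridT T n) (lt_le_trans (u_lt k))// grid_le// ltW.
(* There are k + 1 grid points to inspect but only k increments: the value at the point j uses the
   first j of them. *)
pose E := [set x : k.-tuple R | find (hit x) (iota 0 k.+1) = k].
have mE : measurable E.
  exact: (@measurable_find _ _ (fun j x => @hit k x j) k.+1 k 0 (@mhit k)).
have idxE w : (\1_[set w | idx w = k] w : R) = \1_E (incr k w).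
  rewrite !indicE; congr (nat_of_bool _)%:R.
  have h : (idx w == k) = (find (hit (incr k w)) (iota 0 k.+1) == k).
    rewrite find_iota_eq// grid_index_eq// hitE//; congr (_ && _).
    by apply: eq_in_all => j; rewrite mem_iota => /andP[_ jk]; rewrite hitE// ltnW.
  by apply/idP/idP; rewrite !inE /E/= => /eqP; [rewrite h|rewrite -h] => /eqP.
pose F (z : k.-tuple R * R) := ((f (path_of z.1 k + z.2))%:E * (\1_E z.1)%:E)%E.
have mF : measurable_fun setT F.
  apply: emeasurable_funM; apply/measurable_EFinP.
    apply: measurableT_comp; first exact: continuous_measurable_fun.
    apply: measurable_funD; last exact: measurable_snd.
    apply: (measurableT_comp (f := fun x : k.-tuple R => path_of x k)).
      exact: measurable_path_of.
    exact: measurable_fst.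
  by apply: measurableT_comp => //; exact: measurable_fst.
have F0 z : (0 <= F z)%E.
  by rewrite mule_ge0// lee_fin; case/andP: (fM (path_of z.1 k + z.2)).
have := @increments_markov _ _ _ P W mW indepW u u0 u_lt k T F ukT mF F0.
rewrite /F /=; under eq_integral do rewrite path_of_increments// subrKC -idxE.
move=> ->; apply: eq_integral => w _; rewrite -idxE path_of_increments//.
rewrite -(heat_increment _ cf fM _ ukT) ?grid_ge0 ?ltW// ge0_integralZr//.
- apply/measurable_EFinP; apply: measurableT_comp; first exact: continuous_measurable_fun.
  by apply: measurable_funD => //; exact: measurable_funB.
- by move=> w' _; rewrite lee_fin; case/andP: (fM (W (u k) w + (W T w' - W (u k) w'))).
Qed.

Let grid_markov f : continuous f -> ge0_bounded f ->
    (\int[P]_w (f (W T w))%:E =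
     \int[P]_w (heat f (T - u (idx w)) (W (u (idx w)) w))%:E)%E.
Proof.
move=> cf [M fM].
have splitI (X : Omega -> R) : measurable_fun setT X -> (forall w, 0 <= X w) ->
    (\int[P]_w (X w)%:E = \sum_(k < n.+2) \int[P]_w ((X w)%:E * (\1_[set w | idx w = k] w)%:E))%E.
  move=> mX X0; rewrite -ge0_integral_sum//.
  - apply: eq_integral => w _.
    have kn : (idx w < n.+2)%N by rewrite ltnS; exact: grid_index_le.
    rewrite (bigD1 (Ordinal kn))//= big1 ?adde0.
      by rewrite indicE mem_set// mule1.
    move=> j jk; rewrite indicE memNset ?mule0//=.
    by move=> h; move/eqP: jk; apply; apply/val_inj.
  - move=> k'; apply: emeasurable_funM; apply/measurable_EFinP => //.
  - by move=> k' w _; rewrite mule_ge0// lee_fin.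
rewrite (splitI (fun w => f (W T w))); first last.
- by move=> w; case/andP: (fM (W T w)).
- by apply: measurableT_comp => //; exact: continuous_measurable_fun.
rewrite (splitI (fun w => heat f (T - u (idx w)) (W (u (idx w)) w))); first last.
- by move=> w; case/andP: (heat_bounds (T - u (idx w)) (W (u (idx w)) w) cf fM).
- by apply: (@grid_meas (fun t y => heat f (T - t) y)); apply: heat_cvg => //; exists M.
apply: eq_bigr => k _.
transitivity (\int[P]_w ((heat f (T - u k) (W (u k) w))%:E * (\1_[set w | idx w = k] w)%:E))%E; last first.
  apply: eq_integral => w _; rewrite indicE; have [|] := boolP (w \in _); last by rewrite !mule0.
  by rewrite inE /= => ->.
(* The last index n + 1 stands for the time T: no time is left, and [heat] is the identity. *)
have := ltn_ord k; rewrite ltnS leq_eqVlt => /predU1P[->|kn]; last exact: grid_markov_on.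
have -> : u n.+1 = T by exact: gridT.
by rewrite subrr; under [RHS]eq_integral do rewrite heat_le0//.
Qed.

Lemma markov_time_grid : markov_time T (fun w => grid T n (grid_index (fun s => rho (W s w) - s) e T n)).
Proof.
split; [move=> w|exact: grid_meas|exact: grid_sym|exact: grid_markov].
by rewrite grid_ge0 ?(ltW T_gt0)//= -[leRHS](gridT T n) grid_le ?grid_index_le// ltW.
Qed.

End grid_times.

Lemma markov_time_passage_time T rho : 0 < T -> continuous rho -> (forall x, rho (- x) = rho x) ->
  markov_time T (fun w => passage_time (nonpos (fun s => rho (W s w) - s)) T).
Proof.
move=> T0 crho rhoN.
have cpsi w : continuous (fun s => rho (W s w) - s).
  move=> s; apply: cvgB; last exact: cvg_id.
  by apply: continuous_comp; [exact: cW|exact: crho].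
(* The outer limit lowers the threshold to 0, the inner one refines the grid at a fixed
   threshold. *)
apply: (@markov_time_lim _ (fun m w => passage_time (below (fun s => rho (W s w) - s) m.+1%:R^-1) T)).
  move=> m; apply: (@markov_time_lim _ (fun n w => grid T n (grid_index (fun s => rho (W s w) - s) m.+1%:R^-1 T n))).
    by move=> n; exact: markov_time_grid.
  by move=> w; apply: cvg_grid_below => //; exact: ltW.
by move=> w; apply: cvg_below_nonpos => //; exact: ltW.
Qed.

End stopping.

(** * The function [g] as an excess of absolute moments *)

Lemma g_le0 {R : realType} (t y : R) : t <= 0 -> g t y = 0.
Proof. by rewrite /g => ->. Qed.

Lemma gN {R : realType} (t y : R) : g t (- y) = g t y.
Proof. by rewrite /g sqrrN normrN. Qed.

Lemma g_0r {R : realType} (t : R) : g t 0 = Num.sqrt (2 * t / pi).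
Proof.
rewrite /g; case: ifPn => [t0|_]; last by rewrite normr0 expr0n mul0r oppr0 expR0 mulr1 mul0r subr0.
by rewrite ler0_sqrtr// mulr_le0_ge0 ?invr_ge0 ?pi_ge0// mulr_ge0_le0.
Qed.

Section absolute_moments.
Context {d : measure_display} {Omega : measurableType d} {R : realType}.
Variables (P : probability Omega R) (W : R -> Omega -> R).
Hypothesis bmW : extended_brownian_motion P W.
Implicit Types (s t u x y T M : R).

Let mW : forall t, measurable_fun [set: Omega] (W t). Proof. by case: bmW. Qed.
Let Wle0 : forall t w, t <= 0 -> W t w = 0. Proof. by case: bmW. Qed.
Let normalW : forall (s t : R) (A : set R), 0 <= s -> s < t -> measurable A ->
  P [set w | A (W t w - W s w)] = normal_prob 0 (Num.sqrt (t - s)) A.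
Proof. by case: bmW. Qed.

Let mabs y : measurable_fun setT (fun v : R => (`|y + v|)%:E).
Proof. by apply/measurable_EFinP; apply: measurableT_comp => //; exact: measurable_funD. Qed.

Lemma integral_normr_increment s t y : 0 <= s -> s < t ->
  (\int[P]_w (`|y + (W t w - W s w)|)%:E = (`|y| + g (t - s) y)%:E)%E.
Proof.
move=> s0 st.
have ts : 0 <= t - s by rewrite subr_ge0 ltW.
have q0 : 0 < Num.sqrt (t - s) by rewrite sqrtr_gt0 subr_gt0.
have abs0 (v : R) : (0 <= (`|y + v|)%:E)%E by rewrite lee_fin.
rewrite (distribution_increment mW normalW s0 st (mabs y) abs0).
by rewrite (integral_normr_normal q0) (sqr_sqrtr ts).
Qed.

Lemma integral_normr_W u y : (\int[P]_w (`|y + W u w|)%:E = (`|y| + g u y)%:E)%E.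
Proof.
have [u0|u0] := leP u 0.
  under eq_integral do rewrite Wle0// addr0.
  by rewrite integral_cst//= probability_setT mule1 g_le0// addr0.
rewrite -[in RHS](subr0 u) -integral_normr_increment//.
by apply: eq_integral => w _; rewrite [W 0 w]Wle0// subr0.
Qed.

(** Take expectations in 2|y| <= |y + W_u| + |-y + W_u|; both terms on the right have the same mean
    because [g] is even in y. *)
Lemma g_ge0 u y : 0 <= g u y.
Proof.
have mX z : measurable_fun setT (fun w => (`|z + W u w|)%:E).
  by apply/measurable_EFinP; apply: measurableT_comp => //; exact: measurable_funD.
have h : ((`|y| + `|y|)%:E <= (\int[P]_w (`|y + W u w|)%:E + \int[P]_w (`|- y + W u w|)%:E))%E.
  rewrite -ge0_integralD//.
  rewrite -[leLHS]mule1 -(probability_setT P) -integral_cst//.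
  apply: ge0_le_integral => //.
  - by move=> w _; rewrite lee_fin addr_ge0.
  - exact: emeasurable_funD.
  - move=> w _; rewrite -EFinD lee_fin.
    have -> : `|y| + `|y| = `|(y + W u w) - (- y + W u w)|.
      by rewrite opprD opprK addrACA subrr addr0 -mulr2n normrMn mulr2n.
    exact: ler_normB.
move: h; rewrite !integral_normr_W normrN gN -EFinD lee_fin; lra.
Qed.

(** For 0 <= s < t the left-hand side is g (t - s) 0, which equals the bound. Only the freezing at
    negative times makes it an inequality. *)
Lemma integral_normr_W_diff s t :
  (\int[P]_w (`|W t w - W s w|)%:E <= (Num.sqrt (2 * `|t - s| / pi))%:E)%E.
Proof.
wlog st : s t / s <= t.
  move=> h; have [/h//|/ltW/h] := leP s t.
  by rewrite distrC; under eq_integral do rewrite distrC.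
have [t0|t0] := leP t 0.
  rewrite integral0_eq ?lee_fin ?sqrtr_ge0// => w _.
  by rewrite !Wle0// ?(le_trans st)// subrr normr0.
(* A negative s is raised to 0, which leaves the value of W unchanged and shortens the interval. *)
have [s' [s'0 s't' ss'] Ws] : exists2 s', [/\ 0 <= s', s' <= t & s <= s'] & forall w, W s w = W s' w.
  have [s0|/ltW s0] := leP 0 s; first by exists s.
  by exists 0 => [|w]; [split => //; exact: ltW|rewrite !Wle0].
have [<-|s't] := eqVneq s' t.
  rewrite integral0_eq ?lee_fin ?sqrtr_ge0// => w _.
  by rewrite Ws subrr normr0.
have {}s't : s' < t by rewrite lt_neqAle s't.
under eq_integral do rewrite Ws -[X in `|X|]add0r.
rewrite integral_normr_increment// normr0 add0r g_0r lee_fin.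
apply: ler_wsqrtr; apply: ler_wpM2r; first by rewrite invr_ge0 pi_ge0.
by rewrite ler_pM2l// ger0_norm ?subr_ge0// lerD2l lerN2.
Qed.

(** Both moments are realised by the same path, and the triangle inequality is integrated: the shift
    costs |y - y'| and the change of time costs the mean of |W_u - W_u'|. *)
Lemma normr_g_lipschitz u u' y y' :
  `|y| + g u y <= `|y'| + g u' y' + `|y - y'| + Num.sqrt (2 * `|u - u'| / pi).
Proof.
rewrite -lee_fin -integral_normr_W [leRHS]EFinD [X in (_ <= X + _)%E]EFinD -integral_normr_W -addeA.
have m1 : measurable_fun setT (fun w => (`|y' + W u' w|)%:E).
  by apply/measurable_EFinP; apply: measurableT_comp => //; exact: measurable_funD.
have m0 : measurable_fun setT (fun w => (`|y + W u w|)%:E).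
  by apply/measurable_EFinP; apply: measurableT_comp => //; exact: measurable_funD.
have m2 : measurable_fun setT (fun w => (`|W u w - W u' w|)%:E).
  by apply/measurable_EFinP; apply: measurableT_comp => //; exact: measurable_funB.
apply: (@le_trans _ _ (\int[P]_w (`|y' + W u' w|)%:E + (\int[P]_w (`|y - y'|)%:E + \int[P]_w (`|W u w - W u' w|)%:E))%E).
  rewrite -ge0_integralD// -ge0_integralD//; last 2 first.
    by move=> w _; rewrite -EFinD lee_fin addr_ge0.
    exact: emeasurable_funD.
  apply: ge0_le_integral => //.
    by apply: emeasurable_funD => //; exact: emeasurable_funD.
  move=> w _; rewrite -!EFinD lee_fin.
  have -> : y + W u w = y' + W u' w + ((y - y') + (W u w - W u' w)) by ring.
  by rewrite (le_trans (ler_normD _ _))// lerD2l ler_normD.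
by rewrite leeD2l// leeD// ?integral_normr_W_diff// integral_cst//= probability_setT mule1.
Qed.

Lemma g_le_sqrt u y : g u y <= Num.sqrt (2 * `|u| / pi).
Proof.
have := normr_g_lipschitz u 0 y y.
rewrite (g_le0 y (lexx 0)) subr0 subrr normr0 !addr0; lra.
Qed.

(** The modulus of continuity comes from the coupling bound, so it also covers u = 0, where the
    explicit formula is singular. *)
Lemma g_cvg : cvg_continuous2 (@g R).
Proof.
move=> u v a b ua vb.
have e1 : `|v n - b| @[n --> \oo] --> (0 : R).
  rewrite -(@normr0 _ R); apply: cvg_norm; rewrite -(subrr b); apply: cvgB => //; exact: cvg_cst.
have e2 : Num.sqrt (2 * `|u n - a| / pi) @[n --> \oo] --> (0 : R).
  rewrite -(@sqrtr0 R).
  apply: (@continuous_cvg_seq R (@Num.sqrt R)); first exact: sqrt_continuous.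
  have -> : 0 = 2 * 0 / pi :> R by rewrite mulr0 mul0r.
  apply: cvgMr_tmp; apply: cvgMl_tmp.
  rewrite -(@normr0 _ R); apply: cvg_norm; rewrite -(subrr a); apply: cvgB => //; exact: cvg_cst.
have e : `|v n - b| + Num.sqrt (2 * `|u n - a| / pi) @[n --> \oo] --> (0 : R).
  by rewrite -[X in _ --> X](addr0 0); exact: cvgD.
have h : `|v n| + g (u n) (v n) @[n --> \oo] --> `|b| + g a b.
  apply/cvgrPdist_le => eps eps0.
  move/cvgrPdist_le : e => /(_ _ eps0); apply: filterS => n.
  rewrite sub0r normrN ger0_norm ?addr_ge0 ?sqrtr_ge0// => le_eps.
  rewrite ler_norml; apply/andP; split.
    have := normr_g_lipschitz (u n) a (v n) b; lra.
  have := normr_g_lipschitz a (u n) b (v n); rewrite (distrC b) (distrC a); lra.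
have -> : (fun n => g (u n) (v n)) = (fun n => `|v n| + g (u n) (v n) - `|v n|).
  by apply/funext => n; rewrite addrAC subrr add0r.
have -> : g a b = `|b| + g a b - `|b| by rewrite addrAC subrr add0r.
by apply: cvgB => //; exact: cvg_norm.
Qed.

(** * Absolute moments and mean at a Markov time *)

Section stopped_moments.
Variables (T : R) (sigma : Omega -> R).
Hypothesis gs : markov_time P W T sigma.

Let S w := W (sigma w) w.

Lemma markov_time_measurable_S : measurable_fun setT S.
Proof. by apply: (markov_time_measurable gs (H := fun _ y => y)) => u v a b _. Qed.

Let mS := markov_time_measurable_S.

Lemma markov_time_measurable_g x : measurable_fun setT (fun w => g (T - sigma w) (x - S w)).
Proof.
apply: (markov_time_measurable gs (H := fun t y => g (T - t) (x - y))).
move=> u v a b ua vb; apply: g_cvg; by apply: cvgB => //; exact: cvg_cst.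
Qed.

(** Bounded and continuous, so the fields of [markov_time] apply to it; increasing in [n], so
    monotone convergence recovers |x - y|. *)
Definition truncn_abs x (n : nat) y : R := Num.min `|x - y| n%:R.

Lemma continuous_truncn_abs x n : continuous (truncn_abs x n).
Proof.
move=> y; apply: (@continuous_min R R (fun y => `|x - y|) (cst n%:R)); last exact: cvg_cst.
apply: cvg_norm; apply: cvgB; [exact: cvg_cst|exact: cvg_id].
Qed.

Lemma truncn_abs_bounds x n y : 0 <= truncn_abs x n y <= n%:R.
Proof. by rewrite /truncn_abs le_min normr_ge0 ler0n ge_min lexx orbT. Qed.

Lemma truncn_abs_nd x y m n : (m <= n)%N -> truncn_abs x m y <= truncn_abs x n y.
Proof. by move=> mn; rewrite /truncn_abs le_min !ge_min lexx/= ler_nat mn orbT. Qed.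

Lemma truncn_abs_cvg x y : ((truncn_abs x n y)%:E @[n --> \oo] --> (`|x - y|)%:E)%E.
Proof.
apply: cvg_near_cst; near=> n; congr EFin; apply/min_idPl.
by near: n; apply: nbhs_infty_ger.
Unshelve. all: by end_near. Qed.

Lemma truncn_abs_integral_cvg x (X : Omega -> R) : measurable_fun setT X ->
  (\int[P]_w (truncn_abs x n (X w))%:E @[n --> \oo] --> \int[P]_w (`|x - X w|)%:E)%E.
Proof.
move=> mX.
have mt n : measurable_fun setT (fun w => (truncn_abs x n (X w))%:E).
  apply/measurable_EFinP; apply: measurableT_comp => //.
  by apply: continuous_measurable_fun; exact: continuous_truncn_abs.
have := @cvg_monotone_convergence _ _ _ P setT measurableT (fun n w => (truncn_abs x n (X w))%:E) mt.
rewrite (_ : (\int[P]_w limn _)%E = \int[P]_w (`|x - X w|)%:E)%E.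
  apply.
  - by move=> n w _; rewrite lee_fin; case/andP: (truncn_abs_bounds x n (X w)).
  - by move=> w _ m n mn; rewrite lee_fin truncn_abs_nd.
by apply: eq_integral => w _; apply/cvg_lim => //; exact: truncn_abs_cvg.
Qed.

Lemma heat_truncn_abs_cvg x u y :
  ((heat P W (truncn_abs x n) u y)%:E @[n --> \oo] --> (`|x - y| + g u (x - y))%:E)%E.
Proof.
have mX : measurable_fun setT (fun w => y + W u w) by exact: measurable_funD.
have := truncn_abs_integral_cvg (x:=x) mX.
under eq_integral do rewrite -normrN opprB addrAC.
rewrite integral_normr_W -normrN opprB -(gN _ (y - x)) opprB.
under eq_cvg => n do rewrite -(heatE bmW _ _ (@continuous_truncn_abs x n) (truncn_abs_bounds x n)).
exact.
Qed.

(** The semigroup applied to the truncations increases to |x - y| + g u (x - y), so the Markov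
    identity passes to the unbounded function. *)
Lemma markov_time_normr x :
  (\int[P]_w (`|x - W T w|)%:E = \int[P]_w (`|x - S w| + g (T - sigma w) (x - S w))%:E)%E.
Proof.
have h1 := truncn_abs_integral_cvg (x:=x) (mW T).
have e n : (\int[P]_w (truncn_abs x n (W T w))%:E = \int[P]_w (heat P W (truncn_abs x n) (T - sigma w) (S w))%:E)%E.
  apply: (markov_time_heat gs); first exact: continuous_truncn_abs.
  by exists n%:R => y; exact: truncn_abs_bounds.
rewrite (eq_cvg _ _ e) in h1.
apply: (cvg_unique _ h1) => //.
have mh n : measurable_fun setT (fun w => (heat P W (truncn_abs x n) (T - sigma w) (S w))%:E).
  apply/measurable_EFinP.
  apply: (markov_time_measurable gs (H := fun t y => heat P W (truncn_abs x n) (T - t) y)).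
  apply: heat_cvg => //; first exact: continuous_truncn_abs.
  by exists n%:R => y; exact: truncn_abs_bounds.
have := @cvg_monotone_convergence _ _ _ P setT measurableT _ mh.
rewrite (_ : (\int[P]_w limn _)%E = \int[P]_w (`|x - S w| + g (T - sigma w) (x - S w))%:E)%E.
  apply.
  - move=> n w _; rewrite lee_fin.
    by case/andP: (heat_bounds bmW (T - sigma w) (S w) (@continuous_truncn_abs x n) (truncn_abs_bounds x n)).
  - move=> w _ m n mn.
    rewrite !(heatE bmW _ _ (@continuous_truncn_abs x _) (truncn_abs_bounds x _)).
    apply: ge0_le_integral => //.
    + by move=> w' _; rewrite lee_fin; case/andP: (truncn_abs_bounds x m (S w + W (T - sigma w) w')).
    + apply/measurable_EFinP; apply: measurableT_comp.
        by apply: continuous_measurable_fun; exact: continuous_truncn_abs.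
      exact: measurable_funD.
    + apply/measurable_EFinP; apply: measurableT_comp.
        by apply: continuous_measurable_fun; exact: continuous_truncn_abs.
      exact: measurable_funD.
    + by move=> w' _; rewrite lee_fin truncn_abs_nd.
by apply: eq_integral => w _; apply/cvg_lim => //; exact: heat_truncn_abs_cvg.
Qed.

Lemma markov_time_potential x : (\int[P]_w (`|x - S w|)%:E + \int[P]_w (g (T - sigma w) (x - S w))%:E
  = (`|x| + g T x)%:E)%E.
Proof.
rewrite -ge0_integralD//; last 3 first.
- by apply/measurable_EFinP; apply: measurableT_comp => //; exact: measurable_funB.
- by move=> w _; rewrite lee_fin g_ge0.
- by apply/measurable_EFinP; exact: markov_time_measurable_g.
under eq_integral do rewrite -EFinD.
rewrite -markov_time_normr -(normrN x) -gN -integral_normr_W.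
by apply: eq_integral => w _; rewrite -normrN opprB addrC.
Qed.

(** The potential identity at x = 0 bounds E|S| by g T 0, because the other term is nonnegative. *)
Lemma markov_time_integrable : P.-integrable setT (fun w => (S w)%:E).
Proof.
apply/integrableP; split; first exact/measurable_EFinP.
have := markov_time_potential 0; under eq_integral do rewrite sub0r normrN.
move=> h; apply: (@le_lt_trans _ _ (`|0 : R| + g T 0)%:E); last exact: ltry.
by rewrite -h leeDl// integral_ge0// => w _; rewrite lee_fin g_ge0.
Qed.

Lemma markov_time_integral_pos : (\int[P]_w (Num.max (S w) 0)%:E = \int[P]_w (Num.max (- S w) 0)%:E)%E.
Proof.
pose F (n : nat) y : R := Num.min (Num.max y 0) n%:R.
have cF n : continuous (F n).
  move=> y; apply: (@continuous_min R R (fun y => Num.max y 0) (cst n%:R)); last exact: cvg_cst.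
  by apply: (@continuous_max R R id (cst 0)); [exact: cvg_id|exact: cvg_cst].
have F0 n y : 0 <= F n y <= n%:R.
  by rewrite /F le_min le_max lexx orbT ler0n ge_min lexx orbT.
have Fcvg (X : Omega -> R) : measurable_fun setT X ->
    (\int[P]_w (F n (X w))%:E @[n --> \oo] --> \int[P]_w (Num.max (X w) 0)%:E)%E.
  move=> mX.
  have mF n : measurable_fun setT (fun w => (F n (X w))%:E).
    apply/measurable_EFinP; apply: measurableT_comp => //.
    by apply: continuous_measurable_fun; exact: cF.
  have := @cvg_monotone_convergence _ _ _ P setT measurableT _ mF.
  rewrite (_ : (\int[P]_w limn _)%E = \int[P]_w (Num.max (X w) 0)%:E)%E.
    apply.
    - by move=> n w _; rewrite lee_fin; case/andP: (F0 n (X w)).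
    - by move=> w _ m n mn; rewrite lee_fin /F le_min !ge_min lexx/= ler_nat mn orbT.
  apply: eq_integral => w _; apply/cvg_lim => //.
  apply: cvg_near_cst; near=> n; congr EFin; apply/min_idPl.
  by near: n; apply: nbhs_infty_ger.
have h1 := Fcvg S mS.
have mNS : measurable_fun setT (fun w => - S w) by exact: measurableT_comp.
have h2 := Fcvg _ mNS.
have e n : (\int[P]_w (F n (S w))%:E = \int[P]_w (F n (- S w))%:E)%E.
  by apply: (markov_time_sym gs); [exact: cF|exists n%:R; exact: F0].
rewrite (eq_cvg _ _ e) in h1.
exact: (cvg_unique _ h1 h2).
Unshelve. all: by end_near. Qed.

(** By symmetry the positive and negative parts have equal integrals; integrability allows their
    subtraction. *)
Lemma markov_time_mean0 : (\int[P]_w (S w)%:E = 0)%E.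
Proof.
rewrite integralE.
have -> : (\int[P]_w (fun w => (S w)%:E)^\+ w = \int[P]_w (Num.max (S w) 0)%:E)%E.
  by apply: eq_integral => w _; rewrite funeposE EFin_max.
have -> : (\int[P]_w (fun w => (S w)%:E)^\- w = \int[P]_w (Num.max (- S w) 0)%:E)%E.
  by apply: eq_integral => w _; rewrite funenegE EFin_max EFinN.
rewrite markov_time_integral_pos subee//.
have := integrable_neg_fin_num measurableT markov_time_integrable.
rewrite (_ : (\int[P]_w _ = \int[P]_w (Num.max (- S w) 0)%:E)%E)//.
by apply: eq_integral => w _; rewrite funenegE EFin_max EFinN.
Qed.

End stopped_moments.
End absolute_moments.

(** * Extension of Brownian motion to negative times *)

Section extension.
Context {d : measure_display} {Omega : measurableType d} {R : realType}.

Lemma extend_brownian_motion (P : probability Omega R) (B : R -> Omega -> R) :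
  brownian_motion P B -> extended_brownian_motion P (fun t => B (Num.max 0 t)).
Proof.
move=> [mB B0 cB normalB indepB]; split.
- by move=> t; apply: mB; rewrite le_max lexx.
- by move=> t w t0; rewrite max_l.
- move=> w a.
  have m0 (t : R) : Num.max 0 t \in `[0, +oo[ by rewrite in_itv/= andbT le_max lexx.
  have /subspace_continuousP /(_ _ (m0 a)) := cB w.
  have cm : Num.max 0 t @[t --> a] --> Num.max 0 a.
    by apply: (@continuous_max R R (cst 0) id); [exact: cvg_cst|exact: cvg_id].
  move=> h V /h /cm hV.
  have hV' : \forall t \near a, `[0, +oo[%classic (Num.max 0 t) -> V (B (Num.max 0 t) w) := hV.
  have : \forall t \near a, V (B (Num.max 0 t) w).
    by apply: filterS hV' => t k; exact: k (m0 t).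
  exact.
- move=> s t A s0 st mA; rewrite !max_r//; first exact: normalB.
  by rewrite (le_trans s0)// ltW.
- move=> n t A t0 tle mA.
  have tn i : 0 <= t i by elim: i => // i IH; rewrite (le_trans IH).
  under [in RHS]eq_bigr do rewrite !max_r//.
  apply: etrans (indepB n t A t0 tle mA).
  by congr (P _); apply/seteqP; split=> w wA i /wA; rewrite !max_r.
Qed.

End extension.

(** * Root barriers *)

Section barrier.
Context {R : realType}.
Local Open Scope ereal_scope.

Lemma barrier_function_ge0 (K : set (\bar R * \bar R)) x : 0 <= barrier_function K x.
Proof. by apply: le_ereal_inf_tmp => t []. Qed.

(** The infimum defining the barrier function is attained: every later time belongs to the barrier
    by its stability under time shifts, and the times t + 1/(n+1) decrease to t inside the closed
    set. *)
Lemma root_barrierP (K : set (\bar R * \bar R)) (t : R) x : root_barrier K -> (0 <= t)%R ->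
  K (t%:E, x) <-> barrier_function K x <= t%:E.
Proof.
move=> [cK K0 Kup Koo _] t0; split.
  by move=> Kt; apply: ereal_inf_lbound; split => //; rewrite lee_fin.
move=> rt.
have Klt (s : R) : t%:E < s%:E -> K (s%:E, x).
  move=> ts; have [u [u0 Ku] us] := ereal_inf_lt (le_lt_trans rt ts).
  have ufin : u \is a fin_num by rewrite ge0_fin_numE// (lt_trans us)// ltry.
  have -> : s%:E = u + (s%:E - u) by rewrite addeC subeK.
  by apply: Kup => //; rewrite sube_ge0 ?ufin ?orbT// ltW.
apply: (closed_cvg _ cK (F := \oo) (u_ := fun n : nat => ((t + n.+1%:R^-1)%:E, x))).
  by apply: nearW => n; apply: Klt; rewrite lte_fin ltrDl invr_gt0.
have h : (t + n.+1%:R^-1)%:E @[n --> \oo] --> t%:E.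
  apply: cvg_EFin; first exact: nearW.
  rewrite -[X in _ --> X](addr0 t); apply: cvgD; first exact: cvg_cst.
  exact: cvg_harmonic.
exact: (cvg_pair h (cvg_cst x)).
Qed.

(* With a cap c > T, replacing r by level r c does not affect the hitting of the
   barrier before T. *)
Definition level (r : \bar R -> \bar R) (c : R) (y : R) : R := fine (mine (r y%:E) c%:E).

Lemma continuous_level (r : \bar R -> \bar R) c : continuous r -> (forall x, 0 <= r x) ->
  (0 <= c)%R -> continuous (level r c).
Proof.
move=> cr r0 c0 y; rewrite /level; apply: fine_cvg; rewrite fineK; last first.
  rewrite ge0_fin_numE; first by rewrite gt_min ltry orbT.
  by rewrite le_min r0 lee_fin.
apply: (@min_fun_continuous _ R (\bar R) (fun y => r y%:E) (cst c%:E)); last exact: cst_continuous.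
by move=> z; apply: continuous_comp => //; exact: cr.
Qed.

Lemma level_le r c t y : (forall x, 0 <= r x) -> (0 <= t)%R -> (t < c)%R ->
  (level r c y <= t)%R = (r y%:E <= t%:E).
Proof.
move=> r0 t0 tc; have c0 : (0 <= c)%R by rewrite (le_trans t0)// ltW.
rewrite /level -lee_fin fineK; last first.
  rewrite ge0_fin_numE; first by rewrite gt_min ltry orbT.
  by rewrite le_min r0 lee_fin.
by rewrite ge_min lee_fin [(c <= t)%R]leNgt tc orbF.
Qed.

Lemma level_lt r c y : r y%:E < c%:E -> 0 <= r y%:E -> (level r c y)%:E = r y%:E.
Proof.
move=> rc r0; rewrite /level min_l ?(ltW rc)// fineK// ge0_fin_numE//.
by rewrite (lt_trans rc)// ltry.
Qed.

Lemma level_ge r c y : c%:E <= r y%:E -> level r c y = c.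
Proof. by move=> rc; rewrite /level min_r. Qed.

Lemma level_le_cap r c y : (forall x, 0 <= r x) -> (0 <= c)%R -> (level r c y <= c)%R.
Proof.
move=> r0 c0; rewrite -lee_fin /level fineK ?ge_min ?lexx ?orbT//.
rewrite ge0_fin_numE; first by rewrite gt_min ltry orbT.
by rewrite le_min r0 lee_fin.
Qed.

Lemma level_ge0 r c y : (forall x, 0 <= r x) -> (0 <= c)%R -> (0 <= level r c y)%R.
Proof. by move=> r0 c0; rewrite /level fine_ge0// le_min r0 lee_fin. Qed.

End barrier.

(** * Hitting the barrier along a single continuous path *)

Section hitting.
Context {R : realType}.
Variable r : \bar R -> \bar R.
Hypothesis r_ge0 : forall x, (0 <= r x)%E.
Hypothesis r_sym : forall x, r (- x)%E = r x.
Hypothesis r_cont : continuous r.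
Hypothesis r_mono : forall x y : \bar R, (0 <= x)%E -> (x <= y)%E -> (r y <= r x)%E.
Variable b : R -> R.
Hypothesis b_cont : continuous b.
Hypothesis b0 : b 0 = 0.
Implicit Types (x y t T c : R).

Definition hit_time : \bar R := ereal_inf [set t%:E | t in [set t : R | 0 < t /\ (r (b t)%:E <= t%:E)%E]].

Local Notation tau := hit_time.
(** The cap T + 1 exceeds every s <= T, so for such s the sign of [psi] decides whether (s, b s)
    lies in the barrier. *)
Let psi T s := level r (T + 1) (b s) - s.

Lemma r_norm (y : R) : r y%:E = r (`|y|)%:E.
Proof. by have [y0|y0] := ger0P y => //; rewrite -r_sym -EFinN. Qed.

Lemma r_normP x y : `|x| <= `|y| -> (r y%:E <= r x%:E)%E.
Proof. by move=> xy; rewrite (r_norm x) (r_norm y) r_mono ?lee_fin. Qed.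

Lemma hit_time_ge0 : (0 <= tau)%E.
Proof. by apply: le_ereal_inf_tmp => _ [t [t0 _] <-]; rewrite lee_fin ltW. Qed.

Lemma hit_time_le t : 0 < t -> (r (b t)%:E <= t%:E)%E -> (tau <= t%:E)%E.
Proof. by move=> t0 rt; apply: ereal_inf_lbound; exists t. Qed.

Lemma psi_cont T : 0 <= T -> continuous (psi T).
Proof.
move=> T0 s; apply: cvgB; last exact: cvg_id.
apply: continuous_comp; first exact: b_cont.
by apply: continuous_level => //; rewrite addr_ge0.
Qed.

Lemma psi_le0 T s : 0 <= s <= T -> (psi T s <= 0) = (r (b s)%:E <= s%:E)%E.
Proof.
move=> /andP[s0 sT]; rewrite /psi subr_le0 level_le//.
by rewrite (le_lt_trans sT)// ltrDl.
Qed.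

Lemma hit_time_passage T : 0 <= T ->
  Order.min T%:E tau = (passage_time (nonpos (psi T)) T)%:E.
Proof.
move=> T0; apply/eqP; rewrite eq_le; apply/andP; split.
- have mfin : Order.min T%:E tau \is a fin_num.
    rewrite ge0_fin_numE; first by rewrite gt_min ltry.
    by rewrite le_min lee_fin T0 hit_time_ge0.
  rewrite -(fineK mfin) lee_fin.
  apply: lb_le_inf; first by exists T; right.
  move=> s [[s0T ps]|->]; last by rewrite -lee_fin fineK// ge_min lexx.
  rewrite -lee_fin fineK// ge_min; apply/orP; right.
  have /andP[s0 sT] := s0T.
  move: ps; rewrite /nonpos/= psi_le0// => rs.
  (* Time 0 counts for [passage_time] but not for [hit_time]. An entrance at 0 means r 0 = 0; then r
     vanishes everywhere by monotonicity and symmetry, every positive time is a hit, and the infimum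
     is again 0. *)
  move: s0; rewrite le_eqVlt => /predU1P[s0|s0]; last exact: hit_time_le.
  apply/lee_addgt0Pr => e e0; rewrite -s0 add0e; apply: hit_time_le => //.
  apply: (@le_trans _ _ 0%E); last by rewrite lee_fin ltW.
  rewrite (le_trans _ (_ : (r 0%E <= 0)%E))//; last by move: rs; rewrite -s0 b0.
  by apply: (@r_normP 0); rewrite normr0.
- have /andP[_ sT] := passage_time_bounds (nonpos (psi T)) T0.
  rewrite le_min lee_fin sT/=; apply: le_ereal_inf_tmp => _ [t [t0 rt] <-].
  rewrite lee_fin; have [tT|/ltW Tt] := leP t T; last exact: le_trans Tt.
  have t0T : 0 <= t <= T by rewrite ltW.
  by apply: passage_time_le => //; rewrite /nonpos/= psi_le0.
Qed.

(** At the hitting time the continuous path meets the boundary of the barrier, not its interior: the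
    continuous function [psi] is zero there. *)
Lemma hit_timeE t : tau = t%:E -> r (b t)%:E = t%:E.
Proof.
move=> taut; have t0 : 0 <= t by rewrite -lee_fin -taut hit_time_ge0.
(* The horizon t + 1 makes the passage occur strictly before it; the cap t + 2 then cannot be the
   value of [level], which equals t. *)
have T0 : 0 <= t + 1 by rewrite addr_ge0.
have := hit_time_passage T0; rewrite taut min_r; last by rewrite lee_fin lerDl.
move=> [tE].
have tT : t < t + 1 by rewrite ltrDl.
have psi0 : 0 <= psi (t + 1) 0 by rewrite /psi subr0 level_ge0// addr_ge0.
have := passage_time_nonpos_eq0 T0 (psi_cont T0) psi0; rewrite -tE => /(_ tT).
rewrite /psi => /eqP; rewrite subr_eq0 => /eqP lE.
have := leP ((t + 1 + 1)%:E) (r (b t)%:E) => -[h|h].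
  by move: lE; rewrite level_ge// => e; exfalso; move: e; lra.
by rewrite -(level_lt h)// lE.
Qed.

(* Beyond time t = r x the barrier contains the level x, which the path cannot
   cross without stopping. *)
Lemma hit_time_confined x t s : 0 < x -> r x%:E = t%:E -> (t%:E < tau)%E -> tau = s%:E ->
  b t <= x /\ b s <= x.
Proof.
move=> x0 rx ttau taus.
have t0 : 0 <= t by rewrite -lee_fin -rx.
have ts : t < s by rewrite -lte_fin -taus.
have btx : b t <= x.
  move: t0; rewrite le_eqVlt => /predU1P[<-|t0]; first by rewrite b0 ltW.
  rewrite leNgt; apply/negP => xb; move: ttau; rewrite ltNge hit_time_le//.
  by rewrite -rx r_mono// lee_fin ltW.
split => //; rewrite leNgt; apply/negP => xbs.
have cb : {within `[t, s], continuous b} by exact: continuous_subspaceT.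
have mx : Num.min (b t) (b s) <= x <= Num.max (b t) (b s).
  by rewrite ge_min btx le_max (ltW xbs) orbT.
have [u] := IVT (ltW ts) cb mx.
rewrite in_itv/= => /andP[tu us] bu.
have us' : u < s.
  by rewrite lt_neqAle us andbT; apply/eqP => e; move: xbs; rewrite -e bu ltxx.
have u0 : 0 < u.
  rewrite lt_neqAle (le_trans t0)// andbT; apply/eqP => e.
  by move: x0; rewrite -bu -e b0 ltxx.
have : (tau <= u%:E)%E by apply: hit_time_le => //; rewrite bu rx lee_fin.
by rewrite taus lee_fin leNgt us'.
Qed.

Lemma hit_time_reflect x t s : 0 < x -> r x%:E = t%:E -> tau = s%:E ->
  `|x - b s| + b s = `|x - b (Num.min t s)| + b (Num.min t s).
Proof.
move=> x0 rx taus; have [st|ts] := leP s t => //.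
have [bt bs] : b t <= x /\ b s <= x by apply: (@hit_time_confined _ t s) => //; rewrite taus lte_fin.
by rewrite !ger0_norm ?subr_ge0// !subrK.
Qed.

End hitting.

Local Opaque g.

(** * The integral equation *)

(** To be read with a = E|x - W_tau|, x + v = E|x - S_T| (the letter x being |x|), and b, b' the
    corresponding truncated expectations. *)
Lemma dist_sandwich (R : realType) (a b b' x v e : R) : `|b - b'| <= e / 3 ->
  a <= b + e / 3 -> b <= a -> b' <= x + v -> x + v <= b' + e / 3 -> `|a - x - v| <= e.
Proof. by rewrite !ler_norml; lra. Qed.

Section root_embedding.
Context {R : realType} {d : measure_display} {Omega : measurableType d}.
Variables (P : probability Omega R) (B : R -> Omega -> R) (mu : probability R R)
  (K : set (\bar R * \bar R)).
Let r := barrier_function K.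
Hypothesis hB : brownian_motion P B.
Hypothesis hmu : zero_mean mu.
Hypothesis hK : root_barrier K.
Hypothesis hsol : solves_skorokhod P B mu (hitting_time B K).
Hypothesis hsym : forall x : \bar R, r (- x)%E = r x.
Hypothesis hcont : continuous r.
Hypothesis hmono : forall x y : \bar R, (0 <= x)%E -> (x <= y)%E -> (r y <= r x)%E.
Implicit Types (x y t T c M : R) (F : R -> R).

Let W t := B (Num.max 0 t).
Let bmW : extended_brownian_motion P W. Proof. exact: extend_brownian_motion. Qed.
Let r_ge0 (x : \bar R) : (0 <= r x)%E. Proof. exact: barrier_function_ge0. Qed.
Let W0 w : W 0 w = 0. Proof. by case: bmW => _ Wle0 _ _ _; exact: Wle0. Qed.
Let Wle0 t w : t <= 0 -> W t w = 0. Proof. by case: bmW => _ Wle0 _ _ _; exact: Wle0. Qed.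
Let cW w : continuous (W ^~ w). Proof. by case: bmW. Qed.
Let tau w := hitting_time B K w.

Let tauE w : tau w = hit_time r (W ^~ w).
Proof.
rewrite /tau /hitting_time /hit_time; congr ereal_inf; apply/seteqP.
split=> _ [t [t0 Kt] <-]; exists t => //; split=> //; move: Kt;
  rewrite /W max_r ?(ltW t0)// root_barrierP// ltW//.
Qed.

Let tau_ge0 w : (0 <= tau w)%E. Proof. by rewrite tauE hit_time_ge0. Qed.

(** [stop_val] is the S_T of the overview and [hit_val] is W_tau. Where tau is infinite, [fine]
    gives time 0, so [hit_val] is 0 there. *)
Definition stop_time T w : R := fine (Order.min T%:E (tau w)).
Definition stop_val T w : R := W (stop_time T w) w.
Definition hit_val w : R := B (fine (tau w)) w.

Lemma hit_valE w : hit_val w = W (fine (tau w)) w.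
Proof. by rewrite /hit_val /W max_r// fine_ge0. Qed.

Lemma stop_timeE T w : (T%:E < tau w)%E -> stop_time T w = T.
Proof. by move=> Tt; rewrite /stop_time min_l// ltW. Qed.

Lemma stop_time_hit T w : (tau w <= T%:E)%E -> stop_time T w = fine (tau w).
Proof. by move=> tT; rewrite /stop_time min_r. Qed.

Lemma stop_val_hit T w : (tau w <= T%:E)%E -> stop_val T w = hit_val w.
Proof. by move=> tT; rewrite /stop_val stop_time_hit// hit_valE. Qed.

Lemma stop_val_le0 T w : T <= 0 -> stop_val T w = 0.
Proof.
move=> T0; apply: Wle0; rewrite /stop_time min_l//.
by rewrite (le_trans _ (tau_ge0 w))// lee_fin.
Qed.

Lemma markov_time_stop_time T : 0 < T -> markov_time P W T (stop_time T).
Proof.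
move=> T0.
have -> : stop_time T = fun w => passage_time (nonpos (fun s => level r (T + 1) (W s w) - s)) T.
  apply/funext => w; rewrite /stop_time tauE (hit_time_passage r_ge0 hsym hmono (W0 w) (ltW T0))//.
apply: markov_time_passage_time => //.
  by apply: continuous_level => //; rewrite addr_ge0// ltW.
by move=> x; rewrite /level EFinN hsym.
Qed.

Lemma measurable_stop_val T : measurable_fun setT (stop_val T).
Proof.
have [T0|T0] := leP T 0.
  rewrite (_ : stop_val T = cst 0); first exact: measurable_cst.
  by apply/funext => w; rewrite stop_val_le0.
exact: (markov_time_measurable_S (markov_time_stop_time T0)).
Qed.

(** It is the pointwise limit of S_n restricted to tau < n: the sequence is eventually constant
    where tau is finite, and identically 0, the default value, where it is infinite. *)
Lemma measurable_hit_val : measurable_fun setT hit_val.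
Proof.
pose Y (n : nat) w := stop_val n.+1%:R w * \1_[set w | stop_time n.+1%:R w < n.+1%:R] w.
apply: (@measurable_fun_cvg _ _ _ _ Y).
  move=> n; apply: measurable_funM; first exact: measurable_stop_val.
  apply: measurable_indic.
  have m : measurable_fun setT (stop_time n.+1%:R).
    by apply: (markov_time_measurable (markov_time_stop_time _) (H := fun t _ => t)) => // u v a b.
  rewrite (_ : [set _ | _] = stop_time n.+1%:R @^-1` `]-oo, n.+1%:R[).
    by rewrite -[X in measurable X]setTI; apply: m => //; exact: measurable_itv.
  by apply/seteqP; split => w; rewrite /= in_itv.
move=> w _; have := tau_ge0 w; case tw : (tau w) => [t| |]// t0.
- apply: cvg_near_cst; near=> n.
  have tn : t < n.+1%:R.
    apply: (@lt_trans _ _ n%:R); last by rewrite ltr_nat.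
    by near: n; exact: nbhs_infty_gtr.
  rewrite /Y stop_val_hit ?tw ?lee_fin ?(ltW tn)// indicE mem_set ?mulr1//=.
  by rewrite stop_time_hit tw// lee_fin ltW.
- rewrite (_ : Y^~ w = cst 0).
    by rewrite hit_valE tw W0; exact: cvg_cst.
  apply/funext => n; rewrite /Y indicE memNset ?mulr0//=.
  by rewrite stop_timeE ?tw ?ltry// ltxx.
Unshelve. all: by end_near. Qed.

Lemma ge0_integral_hit_val (f : R -> \bar R) : measurable_fun setT f -> (forall y, 0 <= f y)%E ->
  (\int[P]_w f (hit_val w) = \int[mu]_y f y)%E.
Proof.
move=> mf f0.
pose Xm := isMeasurableFun.Build _ _ _ _ hit_val measurable_hit_val.
pose X : {mfun Omega >-> R} := HB.pack hit_val Xm.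
rewrite -[LHS](@ge0_integral_distribution _ _ _ _ _ P X f)//.
apply: eq_measure_integral => A mA _; case: hsol => _ _ h _; exact: h.
Qed.

Lemma integral_hit_val0 : P.-integrable setT (fun w => (hit_val w)%:E) /\ (\int[P]_w (hit_val w)%:E = 0)%E.
Proof.
have [imu mu0] := hmu.
have mabs : measurable_fun [set: R] (fun y : R => (`|y|)%:E) by apply/measurable_EFinP; exact: normr_measurable.
have ih : P.-integrable setT (fun w => (hit_val w)%:E).
  apply/integrableP; split; first by apply/measurable_EFinP; exact: measurable_hit_val.
  have := ge0_integral_hit_val mabs (fun y => normr_ge0 y) => ->.
  by move/integrableP : imu => [].
split => //.
pose Xm := isMeasurableFun.Build _ _ _ _ hit_val measurable_hit_val.
pose X : {mfun Omega >-> R} := HB.pack hit_val Xm.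
have mE : measurable_fun setT (fun y : R => y%:E) by exact/measurable_EFinP.
rewrite -[LHS](@integral_distribution _ _ _ _ _ P X (fun y => y%:E) mE ih).
transitivity (\int[mu]_y y%:E)%E.
  apply: eq_measure_integral => A mA _; case: hsol => _ _ h _; exact: h.
by rewrite -[LHS]fineK ?(integrable_fin_num _ imu)//; congr EFin.
Qed.

Lemma ae_tau_lty : {ae P, forall w, (tau w < +oo)%E}.
Proof. by case: hsol. Qed.

(** As tau is almost surely finite, the stopped values are eventually equal to [hit_val]; dominated
    convergence applies. *)
Lemma stop_val_cvg F (u : R^nat) : continuous F -> ge0_bounded F -> u @ \oo --> +oo ->
  (\int[P]_w (F (stop_val (u n) w))%:E @[n --> \oo] --> \int[P]_w (F (hit_val w))%:E)%E.
Proof.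
move=> cF [M FM] uoo.
have mF := continuous_measurable_fun cF.
have m1 n : measurable_fun setT (EFin \o (fun w => F (stop_val (u n) w))).
  by apply/measurable_EFinP; apply: measurableT_comp => //; exact: measurable_stop_val.
have m2 : measurable_fun setT (EFin \o (fun w => F (hit_val w))).
  by apply/measurable_EFinP; apply: measurableT_comp => //; exact: measurable_hit_val.
have cv : {ae P, forall w, setT w -> (EFin \o (fun w => F (stop_val (u n) w))) w @[n --> \oo] --> (EFin \o (fun w => F (hit_val w))) w}.
  apply: filterS ae_tau_lty => w tw _; apply: cvg_near_cst.
  have tfin : tau w \is a fin_num by rewrite ge0_fin_numE.
  move/cvgryPge : uoo => /(_ (fine (tau w))); apply: filterS => n un.
  by rewrite /= stop_val_hit// -(fineK tfin) lee_fin.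
have iM : P.-integrable setT (cst M%:E) by exact: finite_measure_integrable_cst.
have le w n : setT w -> (`|(EFin \o (fun w => F (stop_val (u n) w))) w| <= cst M%:E w)%E.
  by move=> _; rewrite /= lee_fin; have /andP[X0 XM] := FM (stop_val (u n) w); rewrite ger0_norm.
have := dominated_convergence measurableT m1 m2 cv iM (aeW P le).
by move=> -[].
Qed.

(** Each S_T is symmetric, and its law tends to mu as T grows. *)
Lemma mu_sym F : continuous F -> ge0_bounded F ->
  (\int[mu]_y (F y)%:E = \int[mu]_y (F (- y))%:E)%E.
Proof.
move=> cF [M FM].
have cFN : continuous (F \o -%R).
  by move=> x; apply: continuous_comp; [exact: opp_continuous|exact: cF].
have uoo : (fun n : nat => n.+1%:R : R) @ \oo --> +oo.
  by apply/cvgryPge => A; near=> n; rewrite (@le_trans _ _ n%:R)// ?ler_nat//; near: n; exact: nbhs_infty_ger.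
rewrite -(ge0_integral_hit_val (f := fun y => (F y)%:E)); first last.
- by move=> y; rewrite lee_fin; case/andP: (FM y).
- by apply/measurable_EFinP; exact: continuous_measurable_fun.
rewrite -(ge0_integral_hit_val (f := fun y => (F (- y))%:E)); first last.
- by move=> y; rewrite lee_fin; case/andP: (FM (- y)).
- by apply/measurable_EFinP; exact: continuous_measurable_fun.
have b1 : ge0_bounded F by exists M.
have b2 : ge0_bounded (F \o -%R) by exists M => y; exact: FM.
have h1 := stop_val_cvg cF b1 uoo.
have h2 := stop_val_cvg cFN b2 uoo.
have e n : (\int[P]_w (F (stop_val n.+1%:R w))%:E = \int[P]_w ((F \o -%R) (stop_val n.+1%:R w))%:E)%E.
  exact: (markov_time_sym (markov_time_stop_time (ltr0Sn _ _))).
rewrite (eq_cvg _ _ e) in h1.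
exact: (cvg_unique _ h1 h2).
Unshelve. all: by end_near. Qed.

(** The growth of E|x - W| during the time T - r y that is left after stopping at y; it is zero if r
    y >= T. *)
Definition gap T x y : R := g (fine (T%:E - r y%:E)%E) (x - y).

Let gap_eq0 T x y : (T%:E <= r y%:E)%E -> gap T x y = 0.
Proof. by move=> Tr; rewrite /gap g_le0// fine_le0// sube_le0. Qed.

(** The extended real r y is replaced by its capped level, which is continuous in y; where the cap
    is active both sides vanish. *)
Let gapE T x y : 0 <= T -> gap T x y = g (T - level r (T + 1) y) (x - y).
Proof.
move=> T0; have [h|h] := leP (T + 1)%:E (r y%:E); last first.
  rewrite /gap -(level_lt h (r_ge0 _)).
  have -> : (T%:E - (level r (T + 1) y)%:E)%E = (T - level r (T + 1) y)%:E by [].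
  by [].
have T1 : T <= T + 1 by rewrite lerDl.
have Tr : (T%:E <= r y%:E)%E by rewrite (le_trans _ h) ?lee_fin.
rewrite (gap_eq0 x Tr) (level_ge h) g_le0; first by [].
by rewrite subr_le0.
Qed.

Let gap_cont T x : 0 <= T -> continuous (gap T x).
Proof.
move=> T0; rewrite (_ : gap T x = fun y => g (T - level r (T + 1) y) (x - y)); last first.
  by apply/funext => y; rewrite gapE.
apply: cvg_seq_continuous => u a ua; apply: (g_cvg bmW).
  apply: cvgB; first exact: cvg_cst.
  apply: continuous_cvg_seq ua; apply: continuous_level => //.
  by rewrite addr_ge0.
by apply: cvgB => //; exact: cvg_cst.
Qed.

Let gap_bounded T x : 0 <= T -> ge0_bounded (gap T x).
Proof.
move=> T0; exists (Num.sqrt (2 * (T + 1) / pi)) => y; rewrite gapE// (g_ge0 bmW)/=.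
apply: (le_trans (g_le_sqrt bmW _ _)); apply: ler_wsqrtr.
apply: ler_wpM2r; first by rewrite invr_ge0 pi_ge0.
rewrite ler_pM2l// ler_norml; apply/andP; split.
  have : level r (T + 1) y <= T + 1 by apply: level_le_cap => //; rewrite addr_ge0.
  lra.
have : 0 <= level r (T + 1) y by rewrite level_ge0// addr_ge0.
lra.
Qed.

(** If tau <= T, this is r(W_tau) = tau. If tau > T, no time is left on the left-hand side, and on
    the right r(W_tau) = tau exceeds T, so both sides are 0. *)
Let gap_hit T x w : (tau w < +oo)%E -> 0 < T ->
  g (T - stop_time T w) (x - stop_val T w) = gap T x (hit_val w).
Proof.
move=> tw T0; have tfin : tau w \is a fin_num by rewrite ge0_fin_numE.
have rE : r (hit_val w)%:E = tau w.
  rewrite hit_valE -[RHS](fineK tfin).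
  by apply: (hit_timeE r_ge0 hsym hcont hmono (@cW w) (W0 w)); rewrite -tauE fineK.
have [tT|Tt] := leP (tau w) T%:E.
  rewrite (stop_val_hit tT) (stop_time_hit tT) /gap rE.
  have -> : fine (T%:E - tau w)%E = T - fine (tau w) by rewrite -[in LHS](fineK tfin).
  by [].
have Tr : (T%:E <= r (hit_val w)%:E)%E by rewrite rE ltW.
by rewrite (gap_eq0 x Tr) (stop_timeE Tt) subrr (g_le0 _ (lexx 0)).
Qed.

Let gap_def T x y : gap T x y = g (fine (T%:E - r y%:E)%E) (x - y). Proof. by []. Qed.

Local Opaque gap.

Lemma integral_gap_stop T x : 0 < T ->
  (\int[P]_w (`|x - stop_val T w|)%:E + \int[mu]_y (gap T x y)%:E = (`|x| + g T x)%:E)%E.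
Proof.
move=> T0; have gs := markov_time_stop_time T0.
rewrite -(markov_time_potential bmW gs x); congr (_ + _)%E.
have mgap : measurable_fun setT (fun y => (gap T x y)%:E).
  by apply/measurable_EFinP; apply: continuous_measurable_fun; exact: (@gap_cont T x (ltW T0)).
have gap0 y : (0 <= (gap T x y)%:E)%E.
  by have [M hM] := gap_bounded x (ltW T0); rewrite lee_fin; case/andP: (hM y).
rewrite -(ge0_integral_hit_val mgap gap0).
apply: ae_eq_integral => //.
- exact: (measurableT_comp mgap measurable_hit_val).
- by apply/measurable_EFinP; exact: (markov_time_measurable_g bmW gs).
- apply: filterS ae_tau_lty => w tw _ /=; congr EFin.
  by rewrite -gap_hit.
Qed.

Lemma mu_fold F x : 0 < x -> continuous F -> ge0_bounded F ->
  (forall y, `|y| <= x -> F y = 0) ->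
  (\int[mu]_y (F y)%:E = \int[mu]_(y in `]x, +oo[) (F (- y) + F y)%:E)%E.
Proof.
move=> x0 cF [M hM] F0.
pose Fp y : R := F (Num.max y x).
pose Fm y : R := F (Num.min y (- x)).
have cFp : continuous Fp.
  move=> y; apply: (@continuous_comp _ _ _ (fun y => Num.max y x) F); last exact: cF.
  by apply: (@continuous_max R R id (cst x)); [exact: cvg_id|exact: cvg_cst].
have cFm : continuous Fm.
  move=> y; apply: (@continuous_comp _ _ _ (fun y => Num.min y (- x)) F); last exact: cF.
  by apply: (@continuous_min R R id (cst (- x))); [exact: cvg_id|exact: cvg_cst].
have Fp0 y : (0 <= (Fp y)%:E)%E by rewrite lee_fin; case/andP: (hM (Num.max y x)).
have Fm0 y : (0 <= (Fm y)%:E)%E by rewrite lee_fin; case/andP: (hM (Num.min y (- x))).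
have Fx : F x = 0 by apply: F0; rewrite ger0_norm// ltW.
have FNx : F (- x) = 0 by apply: F0; rewrite normrN ger0_norm// ltW.
have FS y : F y = Fp y + Fm y.
  rewrite /Fp /Fm; have [xy|yx] := leP x y; have [yN|Ny] := leP y (- x).
  - by exfalso; move: (lt_le_trans x0 (le_trans xy yN)); rewrite oppr_gt0 ltNge (ltW x0).
  - by rewrite FNx addr0.
  - by rewrite Fx add0r.
  - have yx' : `|y| <= x by rewrite ler_norml (ltW yx) ltW.
    by rewrite Fx FNx addr0 (F0 _ yx').
have mp : measurable_fun setT (fun y => (Fp y)%:E).
  by apply/measurable_EFinP; exact: continuous_measurable_fun.
have mm : measurable_fun setT (fun y => (Fm y)%:E).
  by apply/measurable_EFinP; exact: continuous_measurable_fun.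
have mmN : measurable_fun setT (fun y => (Fm (- y))%:E).
  apply/measurable_EFinP; apply: measurableT_comp; first exact: continuous_measurable_fun.
  exact: oppr_measurable.
transitivity (\int[mu]_y (Fp y)%:E + \int[mu]_y (Fm y)%:E)%E.
  rewrite -ge0_integralD//.
  by apply: eq_integral => y _; rewrite FS EFinD.
rewrite (mu_sym cFm); last by exists M => y; exact: hM.
rewrite -ge0_integralD// [RHS]integral_mkcond; apply: eq_integral => y _.
rewrite patchE; case: ifPn => [|h].
  rewrite inE/= in_itv/= andbT => xy.
  by rewrite -EFinD; congr EFin; rewrite addrC /Fp /Fm max_l ?(ltW xy)// min_l ?lerN2 ?(ltW xy).
have yx : y <= x.
  by rewrite leNgt; apply: contra h => xy; rewrite inE/= in_itv/= xy.
by rewrite /Fp /Fm max_r// min_r ?lerN2// Fx FNx adde0.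
Qed.

Lemma integral_gap_fold T x : 0 < T -> 0 < x -> (T%:E <= r x%:E)%E ->
  (\int[mu]_y (gap T x y)%:E =
   \int[mu]_(y in `]x, +oo[) (g (fine (T%:E - r y%:E)%E) (x + y)
     + g (fine (T%:E - r y%:E)%E) (x - y))%:E)%E.
Proof.
move=> T0 x0 Tx.
have gap0 y : `|y| <= x -> gap T x y = 0.
  move=> yx; apply: gap_eq0; apply: (le_trans Tx).
  by apply: (r_normP hsym hmono); rewrite (ger0_norm (ltW x0)).
rewrite (mu_fold x0 (@gap_cont T x (ltW T0)) (@gap_bounded T x (ltW T0)) gap0).
have gapN y : gap T x (- y) = g (fine (T%:E - r y%:E)%E) (x + y) by rewrite gap_def opprK EFinN hsym.
by apply: eq_integral => y _; rewrite gapN gap_def.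
Qed.

Lemma volterra_rhsE T x : 0 < x -> (T%:E <= r x%:E)%E ->
  (\int[P]_w (`|x - stop_val T w|)%:E = (`|x| + volterra_rhs mu r T x)%:E)%E.
Proof.
(* For T <= 0 the stopped value and every [g] vanish. The case T = 0 is met when r x = 0. *)
move=> x0 Tx; have [T0|T0] := leP T 0.
  under eq_integral do rewrite stop_val_le0// subr0.
  rewrite integral_cst//= probability_setT mule1; congr EFin.
  rewrite /volterra_rhs g_le0// (_ : (\int[mu]_(y in _) _)%R = 0) ?subrr ?addr0//.
  rewrite (@eq_Rintegral _ _ _ mu _ (fun=> 0)).
    by rewrite Rintegral_cst//= mul0r.
  move=> y _; have f0 : fine (T%:E - r y%:E)%E <= 0.
    by rewrite fine_le0// sube_le0 (le_trans _ (r_ge0 _))// lee_fin.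
  by rewrite !g_le0// addr0.
have h := integral_gap_stop x T0.
rewrite (integral_gap_fold T0 x0 Tx) in h.
rewrite /volterra_rhs /Rintegral.
set C := (\int[P]_w _)%E in h *; set I := (\int[mu]_(y in _) _)%E in h *.
have C0 : (0 <= C)%E by apply: integral_ge0 => w _; rewrite lee_fin.
have I0 : (0 <= I)%E.
  by apply: integral_ge0 => y _; rewrite lee_fin addr_ge0// (g_ge0 bmW).
(* The Volterra integral is a term of a finite sum of nonnegative terms, hence finite, and its
   [Rintegral] is the true value. *)
have If : I \is a fin_num.
  by rewrite ge0_fin_numE// (@le_lt_trans _ _ (C + I)%E) ?leeDr// h ltry.
by rewrite addrA EFinB -h fineK// addeK.
Qed.

(** * The equation at finite and at infinite barrier levels *)

Lemma integral_normr_mu x : (\int[mu]_y (`|x - y|)%:E = \int[P]_w (`|x - hit_val w|)%:E)%E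
  /\ (\int[mu]_y (`|x - y|)%:E)%E \is a fin_num.
Proof.
have m : measurable_fun setT (fun y => (`|x - y|)%:E).
  by apply/measurable_EFinP; apply: measurableT_comp => //; exact: measurable_funB.
split; first by rewrite -(ge0_integral_hit_val m).
have [imu _] := hmu.
have : mu.-integrable setT (fun y => (`|x - y|)%:E).
  rewrite (_ : (fun y => _) = abse \o ((cst x%:E) \- EFin)%E)//.
  by apply: integrable_abse; apply: integrableB => //; exact: finite_measure_integrable_cst.
by move/integrable_fin_num; apply.
Qed.

Lemma potential_diff x : potential (dirac (0 : R)) x - potential mu x =
  fine (\int[P]_w (`|x - hit_val w|)%:E)%E - `|x|.
Proof.
rewrite /potential opprK /Rintegral (integral_normr_mu x).1 addrC; congr (_ - _).
have m : measurable_fun [set: R] (fun y => (`|x - y|)%:E).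
  by apply/measurable_EFinP; apply: measurableT_comp => //; exact: measurable_funB.
by rewrite (@integral_dirac _ _ (0 : R) R _ measurableT _ m) diracT mul1e subr0.
Qed.

Lemma volterra_finite x t : 0 < x -> r x%:E = t%:E ->
  potential (dirac (0 : R)) x - potential mu x = volterra_rhs mu r t x.
Proof.
move=> x0 rx; rewrite potential_diff.
have Tx : (t%:E <= r x%:E)%E by rewrite rx.
have hS := volterra_rhsE x0 Tx.
have [iH H0] := integral_hit_val0.
have [iS S0] : P.-integrable setT (fun w => (stop_val t w)%:E) /\ (\int[P]_w (stop_val t w)%:E = 0)%E.
  have [t0|t0] := leP t 0; last first.
    by split; [exact: (markov_time_integrable bmW (markov_time_stop_time t0))|exact: (markov_time_mean0 bmW (markov_time_stop_time t0))].
  rewrite (_ : (fun w => (stop_val t w)%:E) = cst 0%E).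
    by split; [exact: integrable0|rewrite integral_cst// mul0e].
  by apply/funext => w; rewrite stop_val_le0.
have absI (X : Omega -> R) : P.-integrable setT (fun w => (X w)%:E) ->
    P.-integrable setT (fun w => (`|x - X w|)%:E).
  move=> iX; rewrite (_ : (fun w => _) = abse \o ((cst x%:E) \- (fun w => (X w)%:E))%E)//.
  by apply: integrable_abse; apply: integrableB => //; exact: finite_measure_integrable_cst.
have e : (\int[P]_w (`|x - hit_val w|)%:E = \int[P]_w (`|x - stop_val t w|)%:E)%E.
  (* Adding the zero means of W_tau and S_t makes the two integrands equal on almost every path, by
     [hit_time_reflect]. *)
  rewrite -[LHS]adde0 -[in LHS]H0 -[RHS]adde0 -[in RHS]S0.
  rewrite -!integralD//; try exact: absI.
  apply: ae_eq_integral => //.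
  - exact: (measurable_int P (integrableD measurableT (absI _ iH) iH)).
  - exact: (measurable_int P (integrableD measurableT (absI _ iS) iS)).
  apply: filterS ae_tau_lty => w tw _ /=; rewrite -!EFinD; congr EFin.
  have tfin : tau w \is a fin_num by rewrite ge0_fin_numE.
  have taus : hit_time r (W ^~ w) = (fine (tau w))%:E by rewrite -tauE fineK.
  rewrite hit_valE /stop_val.
  rewrite (hit_time_reflect r_ge0 hmono (@cW w) (W0 w) x0 rx taus) /stop_time.
  by rewrite (_ : fine (Order.min t%:E (tau w)) = Num.min t (fine (tau w)))// -[in LHS](fineK tfin) -EFin_min.
by rewrite e hS/= addrAC subrr add0r.
Qed.

(** Truncated expectations of |x - S_T| converge as S_T is eventually W_tau. Uniform integrability
    bounds the truncation error uniformly in T, so the limit of the full expectations is E|x -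
    W_tau|. *)
Lemma volterra_infinite x : 0 < x -> r x%:E = +oo%E ->
  volterra_rhs mu r t x @[t --> +oo] --> (potential (dirac (0 : R)) x - potential mu x).
Proof.
move=> x0 rx; rewrite potential_diff.
have hS T : (\int[P]_w (`|x - stop_val T w|)%:E = (`|x| + volterra_rhs mu r T x)%:E)%E.
  by apply: volterra_rhsE => //; rewrite rx leey.
have [AE Afin] := integral_normr_mu x; rewrite AE in Afin.
set A := (\int[P]_w (`|x - hit_val w|)%:E)%E in Afin *.
apply/cvg_pinftyP => u uoo; apply/cvgrPdist_le => eps eps0.
have eps3 : 0 < eps / 3 by rewrite divr_gt0.
case: (hsol) => _ _ _ /(_ _ eps3)[c c0 ui].
have At := truncn_abs_integral_cvg (P := P) (x := x) measurable_hit_val.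
(* One truncation level serves twice: n >= c + |x| makes the error of S_T at most |S_T| on the event
   |S_T| >= c, and a large n makes the error of W_tau at most eps / 3. *)
have [n [nc nA]] : exists n : nat, c + `|x| <= n%:R /\
    (A <= \int[P]_w (truncn_abs x n (hit_val w))%:E + (eps / 3)%:E)%E.
  rewrite -/A -(fineK Afin) in At *.
  have [nfin /cvgrPdist_le/(_ _ eps3) nA] := (fine_cvgP _ _).1 At.
  apply: (@filter_ex _ (\oo : set_system nat)); near=> n.
  have cn : c + `|x| <= n%:R by near: n; exact: nbhs_infty_ger.
  have fn : (\int[P]_w (truncn_abs x n (hit_val w))%:E)%E \is a fin_num by near: n.
  have an : `|fine A - fine (\int[P]_w (truncn_abs x n (hit_val w))%:E)%E| <= eps / 3 by near: n.
  split=> //; rewrite -(fineK fn) -EFinD lee_fin -lerBlDl.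
  exact: le_trans (ler_norm _) an.
pose D T := (\int[P]_w (truncn_abs x n (stop_val T w))%:E)%E.
pose Doo := (\int[P]_w (truncn_abs x n (hit_val w))%:E)%E.
have mt X : measurable_fun setT X -> measurable_fun setT (fun w : Omega => (truncn_abs x n (X w))%:E).
  move=> mX; apply/measurable_EFinP; apply: measurableT_comp => //.
  by apply: continuous_measurable_fun; exact: continuous_truncn_abs.
have Dcvg : (D (u m) @[m --> \oo] --> Doo)%E.
  apply: stop_val_cvg => //; first exact: continuous_truncn_abs.
  by exists n%:R => y; exact: truncn_abs_bounds.
have Dfin T : D T \is a fin_num.
  apply: (@bounded_fin_num _ _ _ P _ n%:R) => [|w]; last exact: truncn_abs_bounds.
  by apply/measurable_EFinP; apply: mt; exact: measurable_stop_val.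
have Doofin : Doo \is a fin_num.
  apply: (@bounded_fin_num _ _ _ P _ n%:R) => [|w]; last exact: truncn_abs_bounds.
  by apply/measurable_EFinP; apply: mt; exact: measurable_hit_val.
have leD T : 0 <= T -> (D T <= \int[P]_w (`|x - stop_val T w|)%:E <= D T + (eps / 3)%:E)%E.
  move=> T0.
  have mS := measurable_stop_val T.
  have mabs : measurable_fun setT (fun w => (`|x - stop_val T w|)%:E).
    by apply/measurable_EFinP; apply: measurableT_comp => //; exact: measurable_funB.
  apply/andP; split.
    apply: ge0_le_integral => //.
    - by move=> w _; rewrite lee_fin; case/andP: (truncn_abs_bounds x n (stop_val T w)).
    - exact: mt.
    - by move=> w _; rewrite lee_fin ge_min lexx.
  have stE : stopped B (hitting_time B K) T = stop_val T.
    apply/funext => w; rewrite /stopped /stop_val /W max_r//.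
    by apply: fine_ge0; rewrite le_min lee_fin T0 tau_ge0.
  have := ui T T0; rewrite stE => uiT.
  apply: le_trans (leeD (lexx (D T)) uiT).
  rewrite [X in (_ <= _ + X)%E]integral_mkcond.
  set Z := (fun w => (`|stop_val T w|)%:E) \_ _.
  have mZ : measurable_fun setT Z.
    apply/measurable_restrict => //; last first.
      by apply/measurable_EFinP; apply: measurableT_comp => //; exact: measurable_funTS.
    rewrite (_ : [set _ | _] = (fun w => `|stop_val T w|) @^-1` `[c, +oo[).
      rewrite -[X in measurable X]setTI.
      by apply: (measurableT_comp (@normr_measurable R setT) mS) => //; exact: measurable_itv.
    by apply/seteqP; split => w; rewrite /= in_itv/= andbT.
  have Z0 w : (0 <= Z w)%E by rewrite /Z patchE; case: ifP.
  rewrite -ge0_integralD//.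
  - apply: ge0_le_integral => //.
    + by apply: emeasurable_funD => //; exact: mt.
    (* If |S_T| >= c, then |x - S_T| <= |x| + |S_T| <= n + |S_T|; otherwise |x - S_T| <= |x| + c <=
       n and nothing is cut off. *)
    + move=> w _; rewrite /Z patchE; case: ifPn => h.
        rewrite -EFinD lee_fin /truncn_abs.
        case: (leP `|x - stop_val T w| n%:R) => h1; first by rewrite lerDl.
        rewrite (le_trans (ler_normB _ _))// lerD2r (le_trans _ nc)// lerDr//.
      rewrite adde0 lee_fin /truncn_abs le_min lexx/=.
      rewrite (le_trans (ler_normB _ _))// (le_trans _ nc)// addrC lerD2r ltW// ltNge.
      by apply: contra h => h; rewrite inE.
  - by move=> w _; rewrite lee_fin; case/andP: (truncn_abs_bounds x n (stop_val T w)).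
  - exact: mt.
have Doole : (Doo <= A)%E.
  apply: ge0_le_integral => //.
  - by move=> w _; rewrite lee_fin; case/andP: (truncn_abs_bounds x n (hit_val w)).
  - by apply: mt; exact: measurable_hit_val.
  - apply/measurable_EFinP; apply: measurableT_comp => //; apply: measurable_funB => //.
    exact: measurable_hit_val.
  - by move=> w _; rewrite lee_fin ge_min lexx.
have Dcvg' : fine (D (u m)) @[m --> \oo] --> fine Doo.
  by apply: fine_cvg; rewrite fineK.
have /cvgrPdist_le/(_ _ eps3) Dd := Dcvg'.
near=> m.
have um0 : 0 <= u m by near: m; exact: (cvgryPge _).1.
have dm : `|fine Doo - fine (D (u m))| <= eps / 3 by near: m.
have := leD _ um0; rewrite hS => /andP[].
move: nA Doole; rewrite -/Doo -(fineK Afin) -(fineK Doofin) -(fineK (Dfin (u m))) -!EFinD !lee_fin.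
exact: dist_sandwich dm.
Unshelve. all: by end_near. Qed.

End root_embedding.

(** Where r x is infinite, [g t x] and the integral both tend to infinity with t, so the right-hand
    side is read as the limit of their difference. *)
Theorem corollary1 (R : realType) (d : measure_display)
    (Omega : measurableType d) (P : probability Omega R)
    (B : R -> Omega -> R) (mu : probability R R)
    (K : set (\bar R * \bar R)) (r : \bar R -> \bar R)
    (hB : brownian_motion P B)
    (hmu : zero_mean mu)
    (hK : root_barrier K)
    (hr : r = barrier_function K)
    (hreg : regular_barrier_function r)
    (hsol : solves_skorokhod P B mu (hitting_time B K))
    (hsym : forall x : \bar R, r (- x)%E = r x)
    (hcont : continuous r)
    (hmono : forall x y : \bar R, (0 <= x)%E -> (x <= y)%E -> (r y <= r x)%E) :
  forall x : R, 0 < x ->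
    (forall t : R, r x%:E = t%:E ->
      potential (dirac (0 : R)) x - potential mu x = volterra_rhs mu r t x) /\
    (r x%:E = +oo%E ->
      volterra_rhs mu r t x @[t --> +oo] -->
        (potential (dirac (0 : R)) x - potential mu x)).
Proof.
subst r => x x0; split=> [t rt|rx].
  exact: volterra_finite hB hmu hK hsol hsym hcont hmono _ _ x0 rt.
exact: volterra_infinite hB hmu hK hsol hsym hcont hmono _ x0 rx.
Qed.
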